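(* Let $\mathbb{M}$ be a right proper model category in which every object is cofibrant. If $\mathbb{M}$ has weak dependent products, then the homotopy category $\mathrm{Ho}\,\mathbb{M}$ has dependent full diagrams and, in turn, the exact completion $(\mathrm{Ho}\,\mathbb{M})_{\mathrm{ex}}$ is locally cartesian closed.
   Context: Weak limits are defined as limits but without requiring uniqueness of the universal arrow. When every object of $\mathbb{M}$ is cofibrant, $\mathrm{Ho}\,\mathbb{M}$ is equivalent to the quotient of the full subcategory of $\mathbb{M}$ on fibrant objects by the (right) homotopy relation; it has weak finite limits. Weak dependent product. Let $Y\xrightarrow{y}X\xrightarrow{x}J$ be arrows in a category with weak finite limits. Consider diagrams over $y,x$ consisting of objects $U,V$ and arrows $u\colon U\to J$, $p_1\colon V\to U$, $p_2\colon V\to X$, $f\colon V\to Y$ with $yf=p_2$ and with $up_1=xp_2$ a weak pullback square. The arrow $f$ is determined by projections if $fa=fb$ for every pair $a,b\colon T\to V$ with $p_1a=p_1b$ and $p_2a=p_2b$. Such a diagram is a weak dependent product of $y,x$ if $f$ is determined by projections and, for every such diagram $(U',V',u',p_1',p_2',f')$ with $f'$ determined by projections, there are arrows $h\colon U'\to U$ and $l\colon V'\to V$ with $uh=u'$, $p_1l=hp_1'$, $p_2l=p_2'$, $fl=f'$. A category has weak dependent products if every composable pair has one. Dependent full diagram. Let $Y\xrightarrow{y}X\xrightarrow{x}J$ be arrows in a category with weak finite limits. A diagram $(U,V,u,p_1,p_2,f)$ over $y,x$, consisting of objects $U,V$ and arrows $u\colon U\to J$, $p_1\colon V\to U$, $p_2\colon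 V\to X$, $f\colon V\to Y$ with $yf=p_2$ and with $up_1=xp_2$ a weak pullback square ($f$ arbitrary, i.e. not required to be determined by projections), is a dependent full diagram over $y,x$ if for every other such diagram $(U',V',u',p_1',p_2',f')$ over $y,x$ ($f'$ arbitrary) there are an arrow $h\colon U'\to U$, a weak pullback $V\xleftarrow{q}P\xrightarrow{r}U'$ of $V\xrightarrow{p_1}U\xleftarrow{h}U'$ and an arrow $k\colon P\to V'$ such that $uh=u'$, $p_1'k=r$, $p_2'k=p_2q$ and $f'k=fq$. A category has dependent full diagrams if there is one over every composable pair. Exact completion (ex/wlex completion) of a category $\mathbb{C}$ with weak finite limits. A pseudo equivalence relation in $\mathbb{C}$ is a parallel pair $r_1,r_2\colon R\rightrightarrows X$ (not necessarily jointly monic) that is reflexive (there is $\rho\colon X\to R$ with $r_1\rho=r_2\rho=\mathrm{id}_X$), symmetric (there is $\sigma\colon R\to R$ with $r_1\sigma=r_2$, $r_2\sigma=r_1$) and transitive (for a weak pullback $R\xleftarrow{a}T\xrightarrow{b}R$ of $r_2,r_1$ there is $\tau\colon T\to R$ with $r_1\tau=r_1a$, $r_2\tau=r_2b$). Objects of $\mathbb{C}_{\mathrm{ex}}$ are pseudo equivalence relations in $\mathbb{C}$; an arrow from $R\rightrightarrows X$ to $(s_1,s_2)\colon S\rightrightarrows Y$ is an equivalence class of arrows $f\colon X\to Y$ for which there is $\hat f\colon R\to S$ with $s_i\hat f=fr_i$, where $f\sim f'$ if there is $t\colon X\to S$ with $s_1t=f$, $s_2t=f'$. $\mathbb{C}_{\mathrm{ex}}$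 is a (Barr-)exact category with finite limits. *)

(* Defs.v *)
From Stdlib Require Import RelationClasses Morphisms Setoid.
From mathcomp Require Import all_boot.

Set Implicit Arguments.
Unset Strict Implicit.
Unset Printing Implicit Defensive.

Declare Scope cat_scope.
Delimit Scope cat_scope with cat.
Local Open Scope cat_scope.

Reserved Notation "f ≈ g" (at level 70, no associativity).
Reserved Notation "g ∘ f" (at level 40, left associativity).

(* Hom-sets are setoids: [f ≈ g] is equality of arrows, and a quotient of a
   category has the same arrows with a coarser [≈].  An ordinary category is
   the case where [≈] is Leibniz equality. *)

Record category := Category {
  obj :> Type;
  hom : obj -> obj -> Type;
  heq : forall x y : obj, hom x y -> hom x y -> Prop;
  heq_equiv : forall x y : obj, Equivalence (@heq x y);
  idm : forall x : obj, hom x x;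
  comp : forall x y z : obj, hom y z -> hom x y -> hom x z;
  comp_proper : forall x y z : obj,
    Proper (@heq y z ==> @heq x y ==> @heq x z) (@comp x y z);
  comp_idl : forall (x y : obj) (f : hom x y), heq (comp (idm y) f) f;
  comp_idr : forall (x y : obj) (f : hom x y), heq (comp f (idm x)) f;
  comp_assoc : forall (x y z w : obj) (h : hom z w) (g : hom y z) (f : hom x y),
    heq (comp h (comp g f)) (comp (comp h g) f)
}.

Arguments hom {c} x y.
Arguments heq {c x y} f g.
Arguments idm {c} x.
Arguments comp {c x y z} g f.

Notation "f ≈ g" := (heq f g) : cat_scope.
Notation "g ∘ f" := (comp g f) : cat_scope.

#[export] Existing Instance heq_equiv.
#[export] Existing Instance comp_proper.

Lemma heq_refl (C : category) (x y : C) (f : hom x y) : f ≈ f.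
Proof. by reflexivity. Qed.
#[export] Hint Resolve heq_refl : core.

Definition arrow_class (C : category) := forall x y : C, hom x y -> Prop.

Definition opposite (C : category) : category.
Proof.
refine (@Category C (fun x y => @hom C y x) (fun x y f g => f ≈ g) _
          (fun x => idm x) (fun x y z g f => f ∘ g) _ _ _ _).
- move=> x y z g g' eg f f' ef; exact: comp_proper.
- move=> x y f; exact: comp_idr.
- move=> x y f; exact: comp_idl.
- move=> x y z w h g f; symmetry; exact: comp_assoc.
Defined.

(* A diagram shaped by a finite graph.  A finite category is such a graph, with
   the same cones, so these are the finite diagrams in the usual sense. *)
Record finite_diagram (C : category) := FiniteDiagram {
  vertex : finType;
  edge : finType;
  source : edge -> vertex;
  target : edge -> vertex;
  dobj : vertex -> C;
  darr : forall e : edge, hom (dobj (source e)) (dobj (target e))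
}.

Record cone (C : category) (D : finite_diagram C) := Cone {
  apex : C;
  leg : forall v : vertex D, hom apex (dobj v);
  leg_comm : forall e : edge D, darr e ∘ leg (source e) ≈ leg (target e)
}.

Definition cone_map (C : category) (D : finite_diagram C) (K L : cone D)
    (h : hom (apex K) (apex L)) : Prop :=
  forall v : vertex D, leg L v ∘ h ≈ leg K v.

Definition is_weak_limit (C : category) (D : finite_diagram C) (L : cone D) :=
  forall K : cone D, exists h : hom (apex K) (apex L), cone_map h.

Definition is_limit (C : category) (D : finite_diagram C) (L : cone D) :=
  forall K : cone D, exists h : hom (apex K) (apex L),
    cone_map h /\ forall h' : hom (apex K) (apex L), cone_map h' -> h' ≈ h.

Definition has_weak_finite_limits (C : category) :=
  forall D : finite_diagram C, exists L : cone D, is_weak_limit L.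

Definition has_finite_limits (C : category) :=
  forall D : finite_diagram C, exists L : cone D, is_limit L.

Definition has_finite_colimits (C : category) :=
  has_finite_limits (opposite C).

Definition is_terminal (C : category) (t : C) :=
  forall x : C, exists f : hom x t, forall g : hom x t, g ≈ f.

Definition is_initial (C : category) (i : C) :=
  forall x : C, exists f : hom i x, forall g : hom i x, g ≈ f.

Definition is_product (C : category) (a b p : C) (p1 : hom p a) (p2 : hom p b) :=
  forall (t : C) (f : hom t a) (g : hom t b),
    exists h : hom t p, (p1 ∘ h ≈ f /\ p2 ∘ h ≈ g) /\
      forall h' : hom t p, p1 ∘ h' ≈ f -> p2 ∘ h' ≈ g -> h' ≈ h.

(* The cospan is [f, g]; the square is [f ∘ p ≈ g ∘ q]. *)
Definition is_weak_pullback (C : category) (x y z : C)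
    (f : hom x z) (g : hom y z) (o : C) (p : hom o x) (q : hom o y) :=
  f ∘ p ≈ g ∘ q /\
  forall (t : C) (a : hom t x) (b : hom t y), f ∘ a ≈ g ∘ b ->
    exists h : hom t o, p ∘ h ≈ a /\ q ∘ h ≈ b.

Definition is_pullback (C : category) (x y z : C)
    (f : hom x z) (g : hom y z) (o : C) (p : hom o x) (q : hom o y) :=
  f ∘ p ≈ g ∘ q /\
  forall (t : C) (a : hom t x) (b : hom t y), f ∘ a ≈ g ∘ b ->
    exists h : hom t o, (p ∘ h ≈ a /\ q ∘ h ≈ b) /\
      forall h' : hom t o, p ∘ h' ≈ a -> q ∘ h' ≈ b -> h' ≈ h.

Section Slice.
Variables (C : category) (x : C).

Record slice_obj := SliceObj { sdom : C; sarr : hom sdom x }.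

Record slice_hom (a b : slice_obj) := SliceHom {
  smor : hom (sdom a) (sdom b);
  smor_comm : sarr b ∘ smor ≈ sarr a
}.

Definition slice_id (a : slice_obj) : slice_hom a a :=
  @SliceHom a a (idm (sdom a)) (comp_idr _).

Definition slice_comp (a b c : slice_obj) (g : slice_hom b c)
    (f : slice_hom a b) : slice_hom a c.
Proof.
apply: (@SliceHom a c (smor g ∘ smor f)).
by rewrite comp_assoc (smor_comm g) (smor_comm f).
Defined.

Definition slice : category.
Proof.
refine (@Category slice_obj slice_hom (fun a b f g => smor f ≈ smor g) _
          slice_id slice_comp _ _ _ _).
- move=> a b; split.
  + by move=> f; reflexivity.
  + by move=> f g e; symmetry.
  + by move=> f g h e1 e2; transitivity (smor g).
- move=> a b c g g' eg f f' ef; exact: comp_proper.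
- move=> a b f; exact: comp_idl.
- move=> a b f; exact: comp_idr.
- move=> a b c d h g f; exact: comp_assoc.
Defined.

End Slice.

(* [ev : e × a -> b], the product [e × a] being given by [p1, p2], is an
   exponential of [b] by [a]; in the universal property [k] is [h × id_a]. *)
Definition is_exponential (C : category) (a b e p : C)
    (p1 : hom p e) (p2 : hom p a) (ev : hom p b) :=
  is_product p1 p2 /\
  forall (z q : C) (q1 : hom q z) (q2 : hom q a), is_product q1 q2 ->
  forall g : hom q b,
    let transposes (h : hom z e) :=
      forall k : hom q p, p1 ∘ k ≈ h ∘ q1 -> p2 ∘ k ≈ q2 -> ev ∘ k ≈ g in
    exists h : hom z e, transposes h /\
      forall h' : hom z e, transposes h' -> h' ≈ h.

Definition cartesian_closed (C : category) :=
  [/\ exists t : C, is_terminal t,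
      forall a b : C, exists (p : C) (p1 : hom p a) (p2 : hom p b),
        is_product p1 p2
    & forall a b : C, exists (e p : C) (p1 : hom p e) (p2 : hom p a)
        (ev : hom p b), is_exponential p1 p2 ev].

Definition locally_cartesian_closed (C : category) :=
  has_finite_limits C /\ forall x : C, cartesian_closed (slice x).

Section Dependent.
Variables (C : category) (Y X J : C) (y : hom Y X) (x : hom X J).

Record dep_diagram := DepDiagram {
  dU : C;
  dV : C;
  du : hom dU J;
  dp1 : hom dV dU;
  dp2 : hom dV X;
  df : hom dV Y;
  df_over : y ∘ df ≈ dp2;
  dwpb : is_weak_pullback du x dp1 dp2
}.

Definition determined_by_projections (D : dep_diagram) :=
  forall (t : C) (a b : hom t (dV D)),
    dp1 D ∘ a ≈ dp1 D ∘ b -> dp2 D ∘ a ≈ dp2 D ∘ b -> df D ∘ a ≈ df D ∘ b.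

Definition is_weak_dependent_product (D : dep_diagram) :=
  determined_by_projections D /\
  forall D' : dep_diagram, determined_by_projections D' ->
    exists (h : hom (dU D') (dU D)) (l : hom (dV D') (dV D)),
      [/\ du D ∘ h ≈ du D', dp1 D ∘ l ≈ h ∘ dp1 D',
          dp2 D ∘ l ≈ dp2 D' & df D ∘ l ≈ df D'].

Definition is_dependent_full (D : dep_diagram) :=
  forall D' : dep_diagram,
    exists (h : hom (dU D') (dU D)) (P : C) (q : hom P (dV D))
      (r : hom P (dU D')) (k : hom P (dV D')),
      du D ∘ h ≈ du D' /\ is_weak_pullback (dp1 D) h q r /\
      [/\ dp1 D' ∘ k ≈ r, dp2 D' ∘ k ≈ dp2 D ∘ q & df D' ∘ k ≈ df D ∘ q].

End Dependent.

Definition has_weak_dependent_products (C : category) :=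
  forall (Y X J : C) (y : hom Y X) (x : hom X J),
    exists D : dep_diagram y x, is_weak_dependent_product D.

Definition has_dependent_full_diagrams (C : category) :=
  forall (Y X J : C) (y : hom Y X) (x : hom X J),
    exists D : dep_diagram y x, is_dependent_full D.

Section ExactCompletion.
Variable C : category.

(* In [ptrans], when [C] has weak pullbacks, it is equivalent to ask for [tau]
   over one weak pullback of [r2, r1] or over all of them. *)
Record pseudo_eq_rel := PseudoEqRel {
  pX : C;
  pR : C;
  pr1 : hom pR pX;
  pr2 : hom pR pX;
  prefl : exists rho : hom pX pR, pr1 ∘ rho ≈ idm pX /\ pr2 ∘ rho ≈ idm pX;
  psym : exists sigma : hom pR pR, pr1 ∘ sigma ≈ pr2 /\ pr2 ∘ sigma ≈ pr1;
  ptrans : exists (T : C) (a b : hom T pR), is_weak_pullback pr2 pr1 a b /\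
    exists tau : hom T pR, pr1 ∘ tau ≈ pr1 ∘ a /\ pr2 ∘ tau ≈ pr2 ∘ b
}.

Record ex_hom (A B : pseudo_eq_rel) := ExHom {
  emor : hom (pX A) (pX B);
  emor_rel : exists fh : hom (pR A) (pR B),
    pr1 B ∘ fh ≈ emor ∘ pr1 A /\ pr2 B ∘ fh ≈ emor ∘ pr2 A
}.

Definition ex_heq (A B : pseudo_eq_rel) (f g : ex_hom A B) :=
  exists t : hom (pX A) (pR B), pr1 B ∘ t ≈ emor f /\ pr2 B ∘ t ≈ emor g.

Lemma ex_heq_equiv (A B : pseudo_eq_rel) : Equivalence (@ex_heq A B).
Proof.
split.
- move=> f; have [rho [e1 e2]] := prefl B.
  by exists (rho ∘ emor f); rewrite !comp_assoc e1 e2 comp_idl; split.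
- move=> f g [t [t1 t2]]; have [s [e1 e2]] := psym B.
  by exists (s ∘ t); rewrite !comp_assoc e1 e2.
- move=> f g h [t [t1 t2]] [t' [t1' t2']].
  have [T [a [b [[_ wp] [tau [e1 e2]]]]]] := ptrans B.
  have [|k [k1 k2]] := wp _ t t'; first by rewrite t2 t1'.
  by exists (tau ∘ k); rewrite !comp_assoc e1 e2 -!comp_assoc k1 k2.
Qed.

Definition ex_id (A : pseudo_eq_rel) : ex_hom A A.
Proof.
apply: (@ExHom A A (idm (pX A))).
by exists (idm (pR A)); rewrite !comp_idl !comp_idr; split.
Defined.

Definition ex_comp (A B D : pseudo_eq_rel) (g : ex_hom B D) (f : ex_hom A B) :
  ex_hom A D.
Proof.
apply: (@ExHom A D (emor g ∘ emor f)).
have [fh [f1 f2]] := emor_rel f; have [gh [g1 g2]] := emor_rel g.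
exists (gh ∘ fh); rewrite !comp_assoc g1 g2 -!comp_assoc f1 f2.
by split.
Defined.

Lemma ex_heq_of_heq (A B : pseudo_eq_rel) (f g : ex_hom A B) :
  emor f ≈ emor g -> ex_heq f g.
Proof.
move=> e; have [rho [e1 e2]] := prefl B.
exists (rho ∘ emor f); rewrite !comp_assoc e1 e2 comp_idl.
by split.
Qed.

Lemma ex_comp_proper (A B D : pseudo_eq_rel) :
  Proper (@ex_heq B D ==> @ex_heq A B ==> @ex_heq A D) (@ex_comp A B D).
Proof.
move=> g g' [s [s1 s2]] f f' [t [t1 t2]].
apply: (@Equivalence_Transitive _ _ (ex_heq_equiv A D) _ (ex_comp g f')).
- have [gh [g1 g2]] := emor_rel g.
  exists (gh ∘ t); rewrite !comp_assoc g1 g2 -!comp_assoc t1 t2.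
  by split.
- exists (s ∘ emor f'); rewrite !comp_assoc s1 s2.
  by split.
Qed.

Definition exact_completion : category.
Proof.
refine (@Category pseudo_eq_rel ex_hom ex_heq ex_heq_equiv ex_id ex_comp
          ex_comp_proper _ _ _).
- move=> A B f; apply: ex_heq_of_heq; exact: comp_idl.
- move=> A B f; apply: ex_heq_of_heq; exact: comp_idr.
- move=> A B D E h g f; apply: ex_heq_of_heq; exact: comp_assoc.
Defined.

End ExactCompletion.

Section Localization.
Variables (C : category) (W : arrow_class C).

(* [C[W^-1]] by generators and relations: the arrows are the formal composites
   of arrows of [C] and formal inverses of arrows in [W]. *)
Inductive loc_hom : C -> C -> Type :=
| loc_arr (x y : C) : hom x y -> loc_hom x y
| loc_inv (x y : C) (w : hom x y) : W w -> loc_hom y x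
| loc_comp (x y z : C) : loc_hom y z -> loc_hom x y -> loc_hom x z.

Inductive loc_heq : forall x y : C, loc_hom x y -> loc_hom x y -> Prop :=
| loc_refl (x y : C) (f : loc_hom x y) : loc_heq f f
| loc_sym (x y : C) (f g : loc_hom x y) : loc_heq f g -> loc_heq g f
| loc_trans (x y : C) (f g h : loc_hom x y) :
    loc_heq f g -> loc_heq g h -> loc_heq f h
| loc_comp_congr (x y z : C) (g g' : loc_hom y z) (f f' : loc_hom x y) :
    loc_heq g g' -> loc_heq f f' -> loc_heq (loc_comp g f) (loc_comp g' f')
| loc_idl (x y : C) (f : loc_hom x y) :
    loc_heq (loc_comp (loc_arr (idm y)) f) f
| loc_idr (x y : C) (f : loc_hom x y) :
    loc_heq (loc_comp f (loc_arr (idm x))) f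
| loc_assoc (x y z w : C)
    (h : loc_hom z w) (g : loc_hom y z) (f : loc_hom x y) :
    loc_heq (loc_comp h (loc_comp g f)) (loc_comp (loc_comp h g) f)
| loc_arr_congr (x y : C) (f g : hom x y) :
    f ≈ g -> loc_heq (loc_arr f) (loc_arr g)
| loc_arr_comp (x y z : C) (g : hom y z) (f : hom x y) :
    loc_heq (loc_arr (g ∘ f)) (loc_comp (loc_arr g) (loc_arr f))
| loc_invl (x y : C) (w : hom x y) (Ww : W w) :
    loc_heq (loc_comp (loc_inv Ww) (loc_arr w)) (loc_arr (idm x))
| loc_invr (x y : C) (w : hom x y) (Ww : W w) :
    loc_heq (loc_comp (loc_arr w) (loc_inv Ww)) (loc_arr (idm y)).

Definition localization : category.
Proof.
refine (@Category C loc_hom loc_heq _ (fun x => loc_arr (idm x)) loc_comp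
          _ loc_idl loc_idr loc_assoc).
- move=> x y; split; [exact: loc_refl | exact: loc_sym | exact: loc_trans].
- move=> x y z g g' eg f f' ef; exact: loc_comp_congr.
Defined.

End Localization.

Section ArrowClasses.
Variable C : category.

Definition heq_invariant (W : arrow_class C) :=
  forall (x y : C) (f g : hom x y), f ≈ g -> W x y f -> W x y g.

Definition is_retract (a b c d : C) (f : hom a b) (g : hom c d) :=
  exists (i : hom a c) (r : hom c a) (j : hom b d) (s : hom d b),
    [/\ r ∘ i ≈ idm a, s ∘ j ≈ idm b, g ∘ i ≈ j ∘ f & f ∘ r ≈ s ∘ g].

Definition retract_closed (W : arrow_class C) :=
  forall (a b c d : C) (f : hom a b) (g : hom c d),
    is_retract f g -> W c d g -> W a b f.

Definition two_out_of_three (W : arrow_class C) :=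
  forall (x y z : C) (f : hom x y) (g : hom y z),
    [/\ W _ _ f -> W _ _ g -> W _ _ (g ∘ f),
        W _ _ f -> W _ _ (g ∘ f) -> W _ _ g
      & W _ _ g -> W _ _ (g ∘ f) -> W _ _ f].

Definition lifts_against (L R : arrow_class C) :=
  forall (a b x y : C) (i : hom a b) (p : hom x y), L a b i -> R x y p ->
  forall (u : hom a x) (v : hom b y), p ∘ u ≈ v ∘ i ->
    exists d : hom b x, d ∘ i ≈ u /\ p ∘ d ≈ v.

Definition factors_as (L R : arrow_class C) :=
  forall (x y : C) (f : hom x y),
    exists (z : C) (i : hom x z) (p : hom z y),
      [/\ L x z i, R z y p & p ∘ i ≈ f].

Definition meet_class (U V : arrow_class C) : arrow_class C :=
  fun x y f => U x y f /\ V x y f.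

End ArrowClasses.

(* Quillen's closed model categories: finite limits and colimits, and
   factorizations that need not be functorial. *)
Record model_category := ModelCategory {
  mcat :> category;
  weq : arrow_class mcat;
  cof : arrow_class mcat;
  fib : arrow_class mcat;
  weq_heq : heq_invariant weq;
  cof_heq : heq_invariant cof;
  fib_heq : heq_invariant fib;
  model_limits : has_finite_limits mcat;
  model_colimits : has_finite_colimits mcat;
  weq_2of3 : two_out_of_three weq;
  weq_retract : retract_closed weq;
  cof_retract : retract_closed cof;
  fib_retract : retract_closed fib;
  lift_cof_tfib : lifts_against cof (meet_class weq fib);
  lift_tcof_fib : lifts_against (meet_class weq cof) fib;
  factor_cof_tfib : factors_as cof (meet_class weq fib);
  factor_tcof_fib : factors_as (meet_class weq cof) fib
}.

Arguments weq {m} x y f.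
Arguments cof {m} x y f.
Arguments fib {m} x y f.

Definition cofibrant (M : model_category) (x : M) :=
  forall (i : M) (f : hom i x), is_initial i -> cof i x f.

Definition right_proper (M : model_category) :=
  forall (a b e o : M) (w : hom a b) (p : hom e b)
    (w' : hom o e) (p' : hom o a),
    is_pullback w p p' w' -> weq a b w -> fib e b p -> weq o e w'.

Definition homotopy_category (M : model_category) : category :=
  localization (@weq M).

(* Main.v *)
Require Import Defs.
From Stdlib Require Import RelationClasses Morphisms Setoid.
From mathcomp Require Import all_boot.

(* For fibrant [Y], homotopy classes of maps into [Y] form a presheaf inverting
   weak equivalences, so the localization acts on it; hence every arrow of Ho M
   into [Y] comes from M and two maps into [Y] agree in Ho M iff they are
   homotopic.  This gives weak finite limits, and right properness makes the
   pullback along a fibration with fibrant base a weak pullback in Ho M.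

   A composable pair in Ho M is isomorphic to a pair of fibrations [y], [x] over
   a fibrant object.  Take a weak dependent product of [y], [x] in M, with its
   weak pullback replaced by the strict one.  Any diagram over [y], [x] in Ho M
   is refined, by homotopy lifting along [y], by a strict diagram of M over the
   strict pullback, where every arrow is determined by projections; so the weak
   dependent product becomes a dependent full diagram in Ho M.

   For the exact completion of [C], view a pseudo equivalence relation as the
   presheaf on [C] of its generalized elements modulo the relation.  A presheaf
   is of this form as soon as it has a weakly universal element and the locus
   where two of its elements agree is weakly represented.  Limits are immediate.
   Dependent full diagrams make universal quantification along any arrow weakly
   representable, and this yields both conditions for the exponential presheaf
   over a base: a full diagram provides enough maps, from which quantification
   cuts out those compatible with the relations and tells when two agree. *)

Set Implicit Arguments.
Unset Strict Implicit.
Unset Printing Implicit Defensive.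

Local Open Scope cat_scope.

(** * Limits *)

Lemma comp_eql (C : category) (x y z : C) (g : hom y z) (f f' : hom x y) :
  f ≈ f' -> g ∘ f ≈ g ∘ f'.
Proof. by move=> ->. Qed.

(* [U] selects the strict ([U := True]) or the weak ([U := False]) notion. *)
Section Limits.
Variables (U : Prop) (C : category).

Definition limit_if (D : finite_diagram C) (L : cone D) :=
  forall K : cone D, exists h : hom (apex K) (apex L),
    cone_map h /\ (U -> forall h' : hom (apex K) (apex L),
      cone_map h' -> h' ≈ h).

Definition terminal_if (t : C) :=
  forall x : C, exists f : hom x t, U -> forall g : hom x t, g ≈ f.

Definition product_if (a b p : C) (p1 : hom p a) (p2 : hom p b) :=
  forall (t : C) (f : hom t a) (g : hom t b),
    exists h : hom t p, (p1 ∘ h ≈ f /\ p2 ∘ h ≈ g) /\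
      (U -> forall h' : hom t p, p1 ∘ h' ≈ f -> p2 ∘ h' ≈ g -> h' ≈ h).

Definition equalizer_if (a b : C) (f g : hom a b) (o : C) (e : hom o a) :=
  f ∘ e ≈ g ∘ e /\
  forall (t : C) (k : hom t a), f ∘ k ≈ g ∘ k ->
    exists h : hom t o, e ∘ h ≈ k /\
      (U -> forall h' : hom t o, e ∘ h' ≈ k -> h' ≈ h).

Definition pullback_if (x y z : C)
    (f : hom x z) (g : hom y z) (o : C) (p : hom o x) (q : hom o y) :=
  f ∘ p ≈ g ∘ q /\
  forall (t : C) (a : hom t x) (b : hom t y), f ∘ a ≈ g ∘ b ->
    exists h : hom t o, (p ∘ h ≈ a /\ q ∘ h ≈ b) /\
      (U -> forall h' : hom t o, p ∘ h' ≈ a -> q ∘ h' ≈ b -> h' ≈ h).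

Definition basic_limits_if := [/\ exists t : C, terminal_if t,
  forall a b : C, exists (p : C) (p1 : hom p a) (p2 : hom p b),
    product_if p1 p2
  & forall (a b : C) (f g : hom a b), exists (o : C) (e : hom o a),
    equalizer_if f g e].

Lemma pullback_if_exists : basic_limits_if ->
  forall (x y z : C) (f : hom x z) (g : hom y z),
  exists (o : C) (p : hom o x) (q : hom o y), pullback_if f g p q.
Proof.
move=> [_ prod eq] x y z f g.
have [r [r1 [r2 rP]]] := prod x y.
have [o [e [ee eP]]] := eq _ _ (f ∘ r1) (g ∘ r2).
exists o, (r1 ∘ e), (r2 ∘ e); split; first by rewrite !comp_assoc.
move=> t a b eab; have [k [[k1 k2] kU]] := rP t a b.
have [|h [hk hU]] := eP t k; first by rewrite -!comp_assoc k1 k2.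
exists h; split; first by rewrite -!comp_assoc hk.
move=> u h' e1 e2; apply: (hU u); apply: (kU u); by rewrite comp_assoc.
Qed.

Lemma basic_limits_of_limits :
  (forall D : finite_diagram C, exists L : cone D, limit_if L) ->
  basic_limits_if.
Proof.
move=> lim; split.
- pose D := @FiniteDiagram C void void id id (of_void C)
              (fun e => match e with end).
  have [L LP] := lim D; exists (apex L) => x.
  pose K := @Cone C D x (fun e => match e with end) (fun e => match e with end).
  have [h [_ hU]] := LP K; exists h => u g.
  by apply: (hU u); case.
- move=> a b.
  pose D := @FiniteDiagram C bool void (of_void _) (of_void _)
              (fun i => if i then a else b) (fun e => match e with end).
  have [L LP] := lim D.
  exists (apex L), (leg L true), (leg L false) => t f g.
  pose K := @Cone C D t
    (fun i => if i return hom t (if i then a else b) then f else g)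
    (fun e => match e with end).
  have [h [hK hU]] := LP K; exists h; split.
    by split; [exact: (hK true) | exact: (hK false)].
  by move=> u h' e1 e2; apply: (hU u); case.
- move=> a b f g.
  pose D := @FiniteDiagram C bool bool (fun _ => true) (fun _ => false)
              (fun i => if i then a else b) (fun e => if e then f else g).
  have [L LP] := lim D; exists (apex L), (leg L true); split.
    have /= e1 := @leg_comm _ _ L true; have /= e2 := @leg_comm _ _ L false.
    by rewrite e1 e2.
  move=> t k ek.
  pose kl (i : bool) : hom t (if i then a else b) :=
    if i return hom t (if i then a else b) then k else f ∘ k.
  have comm (e : edge D) : darr e ∘ kl (source e) ≈ kl (target e).
    by case: e => //=; symmetry.
  have [h [hK hU]] := LP (@Cone C D t kl comm).
  exists h; split; first exact: (hK true).
  move=> u h' eh; apply: (hU u); case=> //=.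
  have /= e1 := @leg_comm _ _ L true.
  by rewrite -e1 -comp_assoc eh.
Qed.

(** Binary products are iterated along a list of vertices. Projections are indexed by membership
    proofs, and [uniq] keeps the head vertex from also receiving a projection from the tail. *)
Lemma product_family_if (D : finite_diagram C) (s : seq (vertex D)) :
  basic_limits_if -> uniq s ->
  exists (o : C) (p : forall v, v \in s -> hom o (dobj v)),
  forall (t : C) (k : forall v, v \in s -> hom t (dobj v)),
  exists h : hom t o, (forall v (i : v \in s), p v i ∘ h ≈ k v i) /\
    (U -> forall h' : hom t o, (forall v (i : v \in s), p v i ∘ h' ≈ k v i) ->
       h' ≈ h).
Proof.
move=> [[o oP] prod _]; elim: s => [|a s IH] /=.
  move=> _; exists o, (fun v i => False_rect _ (notF i)) => t k.
  have [f fU] := oP t; exists f; split=> [v i|u h' _]; first by case: (notF i).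
  exact: (fU u).
move=> /andP[as' us]; have [L [leg LP]] := IH us.
have [r [r1 [r2 rP]]] := prod (dobj a) L.
have tl v : v \in a :: s -> v <> a -> v \in s.
  by rewrite inE => /orP[/eqP|].
(* At the head vertex the first projection is transported along [v = a]; [p_hd] removes the
   transport by uniqueness of equality proofs on a [finType]. *)
pose p v (i : v \in a :: s) : hom r (dobj v) :=
  match v =P a with
  | ReflectT e => ecast z (hom r (dobj z)) (esym e) r1
  | ReflectF n => leg v (tl v i n) ∘ r2
  end.
have p_hd (i : a \in a :: s) : p a i = r1.
  rewrite /p; case: (a =P a) => [e|//].
  by rewrite (eq_axiomK (esym e)).
have p_tl v (i : v \in a :: s) (j : v \in s) : p v i = leg v j ∘ r2.
  rewrite /p; case: (v =P a) => [e|n]; first by case/negP: as'; case: _ / e.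
  by rewrite (bool_irrelevance (tl v i n) j).
exists r, p => t k.
have cs v : v \in s -> v \in a :: s by rewrite inE orbC => ->.
have [h [hK hU]] := LP t (fun v i => k v (cs v i)).
have [m [[m1 m2] mU]] := rP t (k a (mem_head a s)) h.
have kE v (i j : v \in a :: s) : k v i = k v j by rewrite (bool_irrelevance i j).
exists m; split.
  move=> v i; have := i; rewrite inE => /orP[/eqP e|j].
    by subst v; rewrite p_hd (kE _ _ (mem_head a s)).
  by rewrite (p_tl v i j) -comp_assoc m2 hK (kE _ _ i).
move=> u h' eh; apply: (mU u).
  by rewrite -(eh a (mem_head a s)) p_hd.
apply: (hU u) => v i.
by rewrite comp_assoc -(p_tl v (cs v i) i) eh.
Qed.

(** Starting from the product over all vertices, the edges are imposed one at a time, each by an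
    equalizer. *)
Lemma limits_of_basic_limits : basic_limits_if ->
  forall D : finite_diagram C, exists L : cone D, limit_if L.
Proof.
move=> lim D; have [_ _ eq] := lim.
suff [o [p [pD pP]]] : exists (o : C) (p : forall v, hom o (dobj v)),
    (forall e : edge D, e \in enum (edge D) ->
       darr e ∘ p (source e) ≈ p (target e)) /\
    forall (t : C) (k : forall v, hom t (dobj v)),
    (forall e : edge D, e \in enum (edge D) ->
       darr e ∘ k (source e) ≈ k (target e)) ->
    exists h : hom t o, (forall v, p v ∘ h ≈ k v) /\
      (U -> forall h' : hom t o, (forall v, p v ∘ h' ≈ k v) -> h' ≈ h).
  have pc e : darr e ∘ p (source e) ≈ p (target e) by apply: pD; rewrite mem_enum.
  by exists (Cone pc) => K; apply: (pP _ (leg K)) => e _; apply: leg_comm.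
elim: (enum (edge D)) => [|a s [L [leg [LD LP]]]].
  have [L [leg LP]] := @product_family_if D _ lim (enum_uniq (vertex D)).
  exists L, (fun v => leg v (mem_enum _ v)); split=> // t k _.
  have [h [hK hU]] := LP t (fun v _ => k v); exists h; split=> //.
  move=> u h' eh; apply: (hU u) => v i.
  by rewrite (bool_irrelevance i (mem_enum _ v)).
have [o [e [ee eP]]] := eq _ _ (darr a ∘ leg (source a)) (leg (target a)).
exists o, (fun v => leg v ∘ e); split.
  move=> b; rewrite inE => /orP[/eqP->|bs]; first by rewrite comp_assoc.
  by rewrite comp_assoc LD.
move=> t k kD; have [|m [mK mU]] := LP t k.
  by move=> b bs; apply: kD; rewrite inE bs orbT.
have [|h [hK hU]] := eP t m.
  by rewrite -comp_assoc !mK kD // mem_head.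
exists h; split=> [v|u h' eh]; first by rewrite -comp_assoc hK.
by apply: (hU u); apply: (mU u) => v; rewrite comp_assoc.
Qed.

End Limits.

Lemma weak_basic_limits (C : category) :
  has_weak_finite_limits C <-> basic_limits_if False C.
Proof.
split=> [lim|lim D].
  apply: basic_limits_of_limits => D; have [L LP] := lim D; exists L => K.
  by have [h hK] := LP K; exists h.
have [L LP] := limits_of_basic_limits lim D; exists L => K.
by have [h [hK _]] := LP K; exists h.
Qed.

Lemma strict_basic_limits (C : category) :
  has_finite_limits C <-> basic_limits_if True C.
Proof.
split=> [lim|lim D].
  apply: basic_limits_of_limits => D; have [L LP] := lim D; exists L => K.
  by have [h [hK hU]] := LP K; exists h; split.
have [L LP] := limits_of_basic_limits lim D; exists L => K.
by have [h [hK hU]] := LP K; exists h; split=> //; apply: hU.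
Qed.

Lemma pullbacks_exist (C : category) : has_finite_limits C ->
  forall (x y z : C) (f : hom x z) (g : hom y z),
  exists (o : C) (p : hom o x) (q : hom o y), is_pullback f g p q.
Proof.
move=> /strict_basic_limits lim x y z f g.
have [o [p [q [e pq]]]] := pullback_if_exists lim f g.
exists o, p, q; split=> // t a b eab; have [h [hK hU]] := pq t a b eab.
by exists h; split=> //; apply: hU.
Qed.

Lemma weak_pullbacks_exist (C : category) : has_weak_finite_limits C ->
  forall (x y z : C) (f : hom x z) (g : hom y z),
  exists (o : C) (p : hom o x) (q : hom o y), is_weak_pullback f g p q.
Proof.
move=> /weak_basic_limits lim x y z f g.
have [o [p [q [e pq]]]] := pullback_if_exists lim f g.
exists o, p, q; split=> // t a b eab; have [h [hK _]] := pq t a b eab.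
by exists h.
Qed.

Lemma products_exist (C : category) : has_finite_limits C ->
  forall a b : C, exists (p : C) (p1 : hom p a) (p2 : hom p b),
    is_product p1 p2.
Proof.
move=> /strict_basic_limits[_ prod _] a b; have [p [p1 [p2 pP]]] := prod a b.
exists p, p1, p2 => t f g; have [h [hK hU]] := pP t f g.
by exists h; split=> //; apply: hU.
Qed.

Lemma weak_products_exist (C : category) : has_weak_finite_limits C ->
  forall a b : C, exists (p : C) (p1 : hom p a) (p2 : hom p b),
  forall (t : C) (f : hom t a) (g : hom t b),
    exists h : hom t p, p1 ∘ h ≈ f /\ p2 ∘ h ≈ g.
Proof.
move=> /weak_basic_limits[_ prod _] a b; have [p [p1 [p2 pP]]] := prod a b.
exists p, p1, p2 => t f g; have [h [hK _]] := pP t f g.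
by exists h.
Qed.

Lemma terminal_exists (C : category) : has_finite_limits C ->
  exists t : C, is_terminal t.
Proof.
move=> /strict_basic_limits[[t tP] _ _]; exists t => x.
by have [f fU] := tP x; exists f; apply: fU.
Qed.

(* The weak limit of [W -f-> X <-r1- R -r2-> X <-g- W]. *)
Lemma weak_relation_limit (C : category) : has_weak_finite_limits C ->
  forall (W X R : C) (f g : hom W X) (r1 r2 : hom R X),
  exists (L : C) (e : hom L W) (k : hom L R),
    (r1 ∘ k ≈ f ∘ e /\ r2 ∘ k ≈ g ∘ e) /\
    forall (T : C) (a : hom T W) (b : hom T R),
      r1 ∘ b ≈ f ∘ a -> r2 ∘ b ≈ g ∘ a ->
      exists h : hom T L, e ∘ h ≈ a /\ k ∘ h ≈ b.
Proof.
move=> /weak_basic_limits[_ prod eq] W X R f g r1 r2.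
have [p [p1 [p2 pP]]] := prod W R.
have [o [e [ee eP]]] := eq _ _ (r1 ∘ p2) (f ∘ p1).
have [o' [e' [ee' eP']]] := eq _ _ (r2 ∘ p2 ∘ e) (g ∘ p1 ∘ e).
exists o', (p1 ∘ e ∘ e'), (p2 ∘ e ∘ e'); split.
  by rewrite !comp_assoc ee ee'.
move=> T a b e1 e2; have [k [[k1 k2] _]] := pP T a b.
have [|m [mk _]] := eP _ k; first by rewrite -!comp_assoc k1 k2.
have [|h [hm _]] := eP' _ m; first by rewrite -!comp_assoc mk k1 k2.
by exists h; rewrite -!comp_assoc hm mk k1 k2.
Qed.

Lemma pullback_sym (C : category) (x y z o : C) (f : hom x z) (g : hom y z)
    (p : hom o x) (q : hom o y) : is_pullback f g p q -> is_pullback g f q p.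
Proof.
move=> [e pq]; split=> [|t a b eab]; first by symmetry.
have [h [[h1 h2] hU]] := pq t b a (symmetry eab).
by exists h; split=> // h' e1 e2; apply: hU.
Qed.

Lemma weak_pullback_sym (C : category) (x y z o : C) (f : hom x z) (g : hom y z)
    (p : hom o x) (q : hom o y) :
  is_weak_pullback f g p q -> is_weak_pullback g f q p.
Proof.
move=> [e pq]; split=> [|t a b eab]; first by symmetry.
by have [h [h1 h2]] := pq t b a (symmetry eab); exists h.
Qed.

Lemma pullback_ext (C : category) (x y z o : C) (f : hom x z) (g : hom y z)
    (p : hom o x) (q : hom o y) : is_pullback f g p q ->
  forall (t : C) (h h' : hom t o), p ∘ h ≈ p ∘ h' -> q ∘ h ≈ q ∘ h' -> h ≈ h'.
Proof.
move=> [e pq] t h h' e1 e2.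
have [|k [_ kU]] := pq t (p ∘ h') (q ∘ h'); first by rewrite !comp_assoc e.
by rewrite (kU h) // (kU h').
Qed.

Lemma pullback_weak (C : category) (x y z o : C) (f : hom x z) (g : hom y z)
    (p : hom o x) (q : hom o y) : is_pullback f g p q -> is_weak_pullback f g p q.
Proof.
move=> [e pq]; split=> // t a b eab.
by have [h [h12 _]] := pq t a b eab; exists h.
Qed.

(** Cancellation of pullbacks: the outer rectangle and the square of [f] and [g] are pullbacks,
    hence so is the remaining square. *)
Lemma pullback_pasting (C : category) (x y z o w o' : C) (f : hom x z)
    (g : hom y z) (p : hom o x) (q : hom o y) (a : hom w x) (f' : hom w z)
    (p' : hom o' w) (q' : hom o' y) (c : hom o' o) :
  is_pullback f g p q -> is_pullback f' g p' q' -> f ∘ a ≈ f' ->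
  p ∘ c ≈ a ∘ p' -> q ∘ c ≈ q' -> is_pullback a p p' c.
Proof.
move=> pb [e' pq'] ea e1 e2; have [e pq] := pb; split; first by symmetry.
move=> t u v uv.
have [|h [[h1 h2] hU]] := pq' t u (q ∘ v).
  by rewrite -ea -comp_assoc uv !comp_assoc e.
exists h; split.
  split=> //; apply: (pullback_ext pb); rewrite comp_assoc ?e1 ?e2 //.
  by rewrite -comp_assoc h1.
by move=> h' e3 e4; apply: hU => //; rewrite -e2 -comp_assoc e4.
Qed.

(** * The exact completion *)

(* Generalized elements, at stages in [C], of an object of the exact
   completion. *)
Definition el_eq (C : category) (A : pseudo_eq_rel C) (T : C)
    (a b : hom T (pX A)) :=
  exists t : hom T (pR A), pr1 A ∘ t ≈ a /\ pr2 A ∘ t ≈ b.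

Notation "a ≡ b" := (el_eq a b) (at level 70, no associativity).

#[local] Instance el_eq_equiv (C : category) (A : pseudo_eq_rel C) (T : C) :
  Equivalence (@el_eq C A T).
Proof.
split.
- move=> a; have [r [e1 e2]] := prefl A.
  by exists (r ∘ a); rewrite !comp_assoc e1 e2 comp_idl.
- move=> a b [t [t1 t2]]; have [s [e1 e2]] := psym A.
  by exists (s ∘ t); rewrite !comp_assoc e1 e2.
- move=> a b c [t [t1 t2]] [t' [t1' t2']].
  have [T' [p [q [[_ wp] [tau [e1 e2]]]]]] := ptrans A.
  have [|k [k1 k2]] := wp _ t t'; first by rewrite t2 t1'.
  by exists (tau ∘ k); rewrite !comp_assoc e1 e2 -!comp_assoc k1 k2.
Qed.

#[local] Instance el_eq_proper (C : category) (A : pseudo_eq_rel C) (T : C) :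
  Proper (heq ==> heq ==> iff) (@el_eq C A T).
Proof.
by move=> a a' ea b b' eb; split=> -[t [t1 t2]]; exists t;
  rewrite t1 t2; split=> //; symmetry.
Qed.

Section Elements.
Variable C : category.
Implicit Types A B : pseudo_eq_rel C.

Lemma el_eq_of_heq A (T : C) (a b : hom T (pX A)) : a ≈ b -> a ≡ b.
Proof. by move->; reflexivity. Qed.

Lemma el_eq_comp A (S T : C) (a b : hom T (pX A)) (s : hom S T) :
  a ≡ b -> a ∘ s ≡ b ∘ s.
Proof.
by move=> [t [t1 t2]]; exists (t ∘ s); rewrite !comp_assoc t1 t2.
Qed.

Lemma el_eq_mor A B (f : ex_hom A B) (T : C) (a b : hom T (pX A)) :
  a ≡ b -> emor f ∘ a ≡ emor f ∘ b.
Proof.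
move=> [t [t1 t2]]; have [fh [f1 f2]] := emor_rel f.
by exists (fh ∘ t); rewrite !comp_assoc f1 f2 -!comp_assoc t1 t2.
Qed.

Lemma el_eq_rel A : pr1 A ≡ pr2 A.
Proof. by exists (idm _); rewrite !comp_idr. Qed.

Lemma ex_hom_of_el A B (f : hom (pX A) (pX B)) :
  f ∘ pr1 A ≡ f ∘ pr2 A -> exists g : ex_hom A B, emor g = f.
Proof. by move=> h; exists (ExHom h). Qed.

(** The embedding of [C] in its exact completion: arrows out of this object are the generalized
    elements at stage [T], as [discrete_hom] shows. *)
Definition discrete (T : C) : pseudo_eq_rel C.
Proof.
refine (@PseudoEqRel C T T (idm T) (idm T) _ _ _).
- by exists (idm T); rewrite comp_idl.
- by exists (idm T); rewrite comp_idl.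
- exists T, (idm T), (idm T); split; last by exists (idm T).
  split=> // U a b; rewrite !comp_idl => e.
  by exists a; rewrite !comp_idl e.
Defined.

Lemma discrete_hom A (T : C) (a : hom T (pX A)) :
  exists f : ex_hom (discrete T) A, emor f = a.
Proof. by apply: (@ex_hom_of_el (discrete T)); reflexivity. Qed.

End Elements.

(** * Predicates on generalized elements that are images of an arrow *)

Section WeaklyRepresented.
Variables (C : category) (wlim : has_weak_finite_limits C).

(** The subpresheaf [P] of the representable presheaf on [W] is the image of a single arrow; in
    particular it is stable under precomposition. *)
Definition weakly_represented (W : C) (P : forall T : C, hom T W -> Prop) :=
  exists (W' : C) (w : hom W' W), forall (T : C) (t : hom T W),
    P T t <-> exists h : hom T W', w ∘ h ≈ t.

Lemma weakly_represented_iff (W : C) (P Q : forall T : C, hom T W -> Prop) :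
  (forall T (t : hom T W), P T t <-> Q T t) ->
  weakly_represented P -> weakly_represented Q.
Proof. by move=> PQ [W' [w wP]]; exists W', w => T t; rewrite -PQ. Qed.

Lemma weakly_represented_el_eq (A : pseudo_eq_rel C) (W : C)
    (f g : hom W (pX A)) :
  weakly_represented (fun T (t : hom T W) => f ∘ t ≡ g ∘ t).
Proof.
have [L [e [k [[k1 k2] LP]]]] :=
  weak_relation_limit wlim f g (pr1 A) (pr2 A).
exists L, e => T t; split=> [[r [r1 r2]]|[h <-]].
  by have [h [h1 _]] := LP _ t r r1 r2; exists h.
by exists (k ∘ h); rewrite !comp_assoc k1 k2.
Qed.

Lemma weakly_represented_heq (X W : C) (f g : hom W X) :
  weakly_represented (fun T (t : hom T W) => f ∘ t ≈ g ∘ t).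
Proof.
apply: weakly_represented_iff (@weakly_represented_el_eq (discrete X) W f g).
move=> T t; split=> [[r /=]|e]; last by exists (f ∘ t); rewrite /= !comp_idl.
by rewrite comp_idl => -[-> ->].
Qed.

Lemma weakly_represented_and (W : C) (P Q : forall T : C, hom T W -> Prop) :
  weakly_represented P -> weakly_represented Q ->
  weakly_represented (fun T t => P T t /\ Q T t).
Proof.
move=> [V [v vP]] [V' [v' vP']].
have [o [p [q [e pq]]]] := weak_pullbacks_exist wlim v v'.
exists o, (v ∘ p) => T t; rewrite vP vP'; split.
  move=> [[h eh] [h' eh']]; have [|k [k1 k2]] := pq T h h'; first by rewrite eh eh'.
  by exists k; rewrite -comp_assoc k1.
move=> [h eh]; split; first by exists (p ∘ h); rewrite comp_assoc.
by exists (q ∘ h); rewrite comp_assoc -e.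
Qed.

Lemma weakly_represented_sub (W W' : C) (w : hom W' W)
    (Q : forall T : C, hom T W' -> Prop) :
  weakly_represented Q ->
  weakly_represented (fun T t => exists h : hom T W', w ∘ h ≈ t /\ Q T h).
Proof.
move=> [V [v vP]]; exists V, (w ∘ v) => T t; split.
  by move=> [h [eh /vP[k ek]]]; exists k; rewrite -comp_assoc ek.
move=> [k ek]; exists (v ∘ k); rewrite comp_assoc; split=> //.
by apply/vP; exists k.
Qed.

(** A full diagram over [v], [k] represents the quantifier. If the statement holds at [t], the weak
    pullback of [t] and [k] factors through [v] and is a competing diagram, so [t] factors through
    [du D]. Conversely, a factorization lifts every [a] over [t] to [dV D], and [df D] then provides
    its factorization through [v]. *)
Lemma weakly_represented_forall (full : has_dependent_full_diagrams C)
    (K W : C) (k : hom K W) (Q : forall T : C, hom T K -> Prop) :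
  weakly_represented Q ->
  weakly_represented (fun T (t : hom T W) =>
    forall (S : C) (s : hom S T) (a : hom S K), k ∘ a ≈ t ∘ s -> Q S a).
Proof.
move=> [V [v vP]]; have [D DP] := full _ _ _ v k.
exists (dU D), (du D) => T t; split=> [tQ|[h eh] S s a ea].
  have [o [q [p [e pq]]]] := weak_pullbacks_exist wlim t k.
  have [f ef] := (vP _ _).1 (tQ _ q p (symmetry e)).
  have [h [_ [_ [_ [_ [eh _]]]]]] := DP (DepDiagram ef (conj e pq)).
  by exists h.
have [e pq] := dwpb D.
have [|m [_ m2]] := pq _ (h ∘ s) a; first by rewrite comp_assoc eh ea.
by apply/vP; exists (df D ∘ m); rewrite comp_assoc df_over.
Qed.

End WeaklyRepresented.

(** * Presheaves presented by pseudo equivalence relations *)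

Section Presentation.
Variables (C : category) (wlim : has_weak_finite_limits C).

Record presheaf := Presheaf {
  elt : C -> Type;
  eeq : forall T : C, elt T -> elt T -> Prop;
  res : forall S T : C, hom S T -> elt T -> elt S;
  eeq_equiv : forall T : C, Equivalence (@eeq T);
  res_proper : forall (S T : C) (s s' : hom S T) (c c' : elt T),
    s ≈ s' -> eeq c c' -> eeq (res s c) (res s' c');
  res_comp : forall (R S T : C) (s : hom S T) (r : hom R S) (c : elt T),
    eeq (res (s ∘ r) c) (res r (res s c))
}.

Definition covered (F : presheaf) :=
  exists (X : C) (c : elt F X), forall (T : C) (d : elt F T),
    exists t : hom T X, eeq (res t c) d.

Definition separated (F : presheaf) :=
  forall (T : C) (c d : elt F T),
    weakly_represented (fun S (s : hom S T) => eeq (res s c) (res s d)).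

(** By the Yoneda lemma, [g] is an isomorphism onto [F] from the presheaf of generalized elements of
    [A] modulo the relation. *)
Definition generic (F : presheaf) (A : pseudo_eq_rel C) (g : elt F (pX A)) :=
  (forall (T : C) (d : elt F T), exists a : hom T (pX A), eeq (res a g) d) /\
  forall (T : C) (a b : hom T (pX A)), eeq (res a g) (res b g) <-> a ≡ b.

(* This plays the role of the embedding of the exact completion in presheaves:
   its image consists of the covered and separated presheaves. *)
Lemma presented (F : presheaf) : covered F -> separated F ->
  exists (A : pseudo_eq_rel C) (g : elt F (pX A)), generic g.
Proof.
move=> [X [c cP]] Fsep; pose E := eeq_equiv F.
have [p [p1 [p2 pP]]] := weak_products_exist wlim X X.
(* [R] is the locus in the weak square of [X] where the two restrictions of [c] agree. By [RP], maps
   into [R] witness equality of restrictions of [c], so reflexivity, symmetry and transitivity of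
   [R] come from those of [eeq]. *)
have [R [w wP]] := Fsep _ (res p1 c) (res p2 c).
have RP (T : C) (a b : hom T X) : eeq (res a c) (res b c) <->
    exists t : hom T R, (p1 ∘ w) ∘ t ≈ a /\ (p2 ∘ w) ∘ t ≈ b.
  have rE (t : hom T p) (x : hom p X) (y : hom T X) : x ∘ t ≈ y ->
      eeq (res t (res x c)) (res y c).
    move=> e; transitivity (res (x ∘ t) c); first by symmetry; apply: res_comp.
    by apply: res_proper => //; reflexivity.
  split=> [e|[t [t1 t2]]].
    have [m [m1 m2]] := pP _ a b.
    have [|t et] := (wP _ m).1.
      transitivity (res a c); first exact: rE.
      by transitivity (res b c) => //; symmetry; apply: rE.
    by exists t; rewrite -!comp_assoc et.
  have h := (wP _ (w ∘ t)).2 (ex_intro (fun k => w ∘ k ≈ w ∘ t) t (heq_refl _)).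
  transitivity (res (w ∘ t) (res p1 c)).
    by symmetry; apply: rE; rewrite comp_assoc.
  by transitivity (res (w ∘ t) (res p2 c)) => //; apply: rE; rewrite comp_assoc.
have rP : eeq (res (p1 ∘ w) c) (res (p2 ∘ w) c).
  by apply/RP; exists (idm R); rewrite !comp_idr.
have cE (S T : C) (a b : hom T X) (s : hom S T) :
    eeq (res a c) (res b c) -> eeq (res (a ∘ s) c) (res (b ∘ s) c).
  by rewrite !RP => -[t [t1 t2]]; exists (t ∘ s); rewrite !comp_assoc t1 t2.
have prefl : exists rho : hom X R, (p1 ∘ w) ∘ rho ≈ idm X /\ (p2 ∘ w) ∘ rho ≈ idm X.
  by apply/RP; reflexivity.
have psym : exists sigma : hom R R,
    (p1 ∘ w) ∘ sigma ≈ p2 ∘ w /\ (p2 ∘ w) ∘ sigma ≈ p1 ∘ w.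
  by apply/RP; symmetry.
have ptrans : exists (T : C) (a b : hom T R),
    is_weak_pullback (p2 ∘ w) (p1 ∘ w) a b /\
    exists tau : hom T R, (p1 ∘ w) ∘ tau ≈ (p1 ∘ w) ∘ a /\
      (p2 ∘ w) ∘ tau ≈ (p2 ∘ w) ∘ b.
  have [T [a [b ab]]] := weak_pullbacks_exist wlim (p2 ∘ w) (p1 ∘ w).
  exists T, a, b; split=> //; apply/RP.
  transitivity (res ((p2 ∘ w) ∘ a) c); first exact: cE.
  transitivity (res ((p1 ∘ w) ∘ b) c); last exact: cE.
  by apply: res_proper; [exact: ab.1 | reflexivity].
exists (PseudoEqRel prefl psym ptrans), c; split=> [T d|T a b]; last exact: RP.
exact: cP.
Qed.

Lemma generic_inv (F : presheaf) (A : pseudo_eq_rel C) (g : elt F (pX A)) :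
  generic g -> eeq (res (pr1 A) g) (res (pr2 A) g).
Proof. by move=> [_ gP]; apply/gP; apply: el_eq_rel. Qed.

End Presentation.

(** * Finite limits in the exact completion *)

Section ExactCompletionLimits.
Variables (C : category) (wlim : has_weak_finite_limits C).
Implicit Types A B : pseudo_eq_rel C.

Lemma ex_terminal : exists t : exact_completion C, is_terminal t.
Proof.
pose F := @Presheaf C (fun _ => unit) (fun _ _ _ => True) (fun _ _ _ => id)
  (fun _ => Build_Equivalence _ (fun _ => I) (fun _ _ _ => I) (fun _ _ _ _ _ => I))
  (fun _ _ _ _ _ _ _ _ => I) (fun _ _ _ _ _ _ => I).
have [[o oP] _ _] := (weak_basic_limits C).1 wlim.
have [||A [g [gP gE]]] := @presented _ wlim F.
- by exists o, tt => T d; have [t _] := oP T; exists t.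
- by move=> T c d; exists T, (idm T) => S s; split=> // _;
  exists s; rewrite comp_idl.
exists A => B; have [a _] := gP (pX B) tt.
have [|f ef] := @ex_hom_of_el _ B A a; first by apply/gE.
by exists f => h; apply/gE.
Qed.

(** The presheaf of pairs of elements is covered by a weak product. Its generic pair gives the
    projections, and the pair of arrows out of [T] is an element at stage [pX T], which yields the
    mediating arrow. *)
Lemma ex_products A B : exists (P : exact_completion C)
    (p1 : @hom (exact_completion C) P A) (p2 : @hom (exact_completion C) P B),
  product_if True p1 p2.
Proof.
have equiv (T : C) : Equivalence (fun c d : hom T (pX A) * hom T (pX B) =>
    c.1 ≡ d.1 /\ c.2 ≡ d.2).
  split=> [c|c d [? ?]|c d e [h1 h2] [h3 h4]]; first by split; reflexivity.
    by split; symmetry.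
  by split; [transitivity d.1 | transitivity d.2].
have @F : presheaf C.
  refine (@Presheaf C _ _
    (fun S T s c => (c.1 ∘ s, c.2 ∘ s)) equiv _ _) => /=.
  - move=> S T s s' c c' es [e1 e2]; rewrite es.
    by split; apply: el_eq_comp.
  - by move=> R S T s r c; rewrite !comp_assoc; split; reflexivity.
have [||P [g [gP gE]]] := @presented _ wlim F.
- have [p [p1 [p2 pP]]] := weak_products_exist wlim (pX A) (pX B).
  exists p, (p1, p2) => T [a b]; have [t [t1 t2]] := pP _ a b.
  by exists t; split; apply: el_eq_of_heq.
- move=> T c d; apply: weakly_represented_and => //;
    exact: weakly_represented_el_eq.
have [g1 g2] := generic_inv (conj gP gE).
have [p1 e1] := ex_hom_of_el g1; have [p2 e2] := ex_hom_of_el g2.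
exists P, p1, p2 => T a b; rewrite /= in a b *.
have [h [h1 h2]] := gP _ (emor a, emor b); rewrite /= in h1 h2.
(* Compatibility of [h] with the relation of [T] is tested on the generic pair, whose components
   along [h] are [a] and [b], already known to be compatible. *)
have [|k ek] := @ex_hom_of_el _ T P h.
  apply/gE; split; rewrite /= !comp_assoc.
    transitivity (emor a ∘ pr1 T); first exact: el_eq_comp.
    transitivity (emor a ∘ pr2 T); last by symmetry; apply: el_eq_comp.
    by apply: el_eq_mor; apply: el_eq_rel.
  transitivity (emor b ∘ pr1 T); first exact: el_eq_comp.
  transitivity (emor b ∘ pr2 T); last by symmetry; apply: el_eq_comp.
  by apply: el_eq_mor; apply: el_eq_rel.
exists k; split.
  by split; [change (emor p1 ∘ emor k ≡ emor a)
            |change (emor p2 ∘ emor k ≡ emor b)]; rewrite ek ?e1 ?e2.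
move=> _ k' k1 k2; apply/gE; rewrite ek; split.
  transitivity (emor a); last by symmetry.
  by rewrite /= -e1.
transitivity (emor b); last by symmetry.
by rewrite /= -e2.
Qed.

Lemma ex_equalizers A B (f g : @hom (exact_completion C) A B) :
  exists (E : exact_completion C) (e : @hom (exact_completion C) E A),
  equalizer_if True f g e.
Proof.
pose eqz (T : C) := {a : hom T (pX A) | emor f ∘ a ≡ emor g ∘ a}.
have equiv (T : C) : Equivalence (fun c d : eqz T => sval c ≡ sval d).
  split=> [c|c d|c d e h1 h2]; first reflexivity.
    by symmetry.
  by transitivity (sval d).
have @r (S T : C) (s : hom S T) (c : eqz T) : eqz S.
  exists (sval c ∘ s); rewrite !comp_assoc.
  by apply: el_eq_comp; apply: (svalP c).
have @F : presheaf C.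
  refine (@Presheaf C _ _ r equiv _ _) => /=.
  - by move=> S T s s' c c' es ec /=; rewrite es; apply: el_eq_comp.
  - by move=> R S T s t c /=; rewrite !comp_assoc; reflexivity.
have [||E [c [cP cE]]] := @presented _ wlim F.
- have [W [w wP]] := weakly_represented_el_eq wlim (emor f) (emor g).
  have ew : emor f ∘ w ≡ emor g ∘ w.
    by apply/wP; exists (idm W); rewrite comp_idr.
  exists W, (exist _ w ew) => T [a ea]; have [h eh] := (wP _ _).1 ea.
  by exists h; apply: el_eq_of_heq.
- by move=> T [a ea] [b eb]; apply: (weakly_represented_el_eq wlim a b).
have [e ee] := ex_hom_of_el (generic_inv (conj cP cE)).
exists E, e; split.
  change (emor f ∘ emor e ≡ emor g ∘ emor e); rewrite ee; exact: (svalP c).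
move=> T a ea; have [h /= eh] := cP _ (exist _ (emor a) ea).
have [|k ek] := @ex_hom_of_el _ T E h.
  apply/cE; rewrite /= !comp_assoc.
  transitivity (emor a ∘ pr1 T); first exact: el_eq_comp.
  transitivity (emor a ∘ pr2 T); last by symmetry; apply: el_eq_comp.
  by apply: el_eq_mor; apply: el_eq_rel.
exists k; split.
  by change (emor e ∘ emor k ≡ emor a); rewrite ek ee.
move=> _ k' ek'; apply/cE; rewrite ek /=.
transitivity (emor a); last by symmetry.
by rewrite -ee.
Qed.

Lemma ex_finite_limits : has_finite_limits (exact_completion C).
Proof.
apply/strict_basic_limits; split.
- by have [t tP] := ex_terminal; exists t => x; have [f fP] := tP x; exists f.
- exact: ex_products.
- exact: ex_equalizers.
Qed.

End ExactCompletionLimits.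

(** * The exponential presheaf over a base *)

Section FunctionPresheaf.
Variables (C : category) (wlim : has_weak_finite_limits C).
Variables (A B J : pseudo_eq_rel C) (al : ex_hom A J) (be : ex_hom B J).

(* The value at [T] of the exponential presheaf of [B] by [A] over [J]: an
   element [j] of [J] with a natural map from [j^* A] to [j^* B].  Natural
   maps are encoded by their graphs, so that no choice of values is needed. *)
Record fam (T : C) := Fam {
  fam_base : hom T (pX J);
  fam_graph : forall S : C, hom S T -> hom S (pX A) -> hom S (pX B) -> Prop;
  fam_proper : forall (S : C) (s s' : hom S T) a a' b b',
    s ≈ s' -> a ≡ a' -> b ≡ b' -> fam_graph s a b -> fam_graph s' a' b';
  fam_natural : forall (R S : C) (r : hom R S) (s : hom S T) a b,
    fam_graph s a b -> fam_graph (s ∘ r) (a ∘ r) (b ∘ r);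
  fam_functional : forall (S : C) (s : hom S T) a b b',
    fam_graph s a b -> fam_graph s a b' -> b ≡ b';
  fam_dom : forall (S : C) (s : hom S T) a b,
    fam_graph s a b -> emor al ∘ a ≡ fam_base ∘ s;
  fam_cod : forall (S : C) (s : hom S T) a b,
    fam_graph s a b -> emor be ∘ b ≡ fam_base ∘ s;
  fam_total : forall (S : C) (s : hom S T) a,
    emor al ∘ a ≡ fam_base ∘ s -> exists b, fam_graph s a b
}.

(** One inclusion of graphs suffices: over equal bases, totality of the smaller graph and
    functionality of the larger one force the converse. *)
Definition fam_eq (T : C) (c d : fam T) :=
  fam_base c ≡ fam_base d /\
  forall (S : C) (s : hom S T) a b, fam_graph c s a b -> fam_graph d s a b.

Lemma fam_eq_equiv (T : C) : Equivalence (@fam_eq T).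
Proof.
split=> [c|c d [e h]|c d f [e h] [e' h']].
- by split=> //; reflexivity.
- split=> [|S s a b dab]; first by symmetry.
  have [|b' cab'] := @fam_total _ c S s a.
    transitivity (fam_base d ∘ s); first exact: fam_dom dab.
    by symmetry; apply: el_eq_comp.
  apply: (fam_proper _ _ _ cab') => //; first reflexivity.
  exact: fam_functional (h _ _ _ _ cab') dab.
- by split=> [|S s a b /h/h']; first by transitivity (fam_base d).
Qed.

Definition fam_res (S T : C) (t : hom S T) (c : fam T) : fam S.
Proof.
refine (@Fam S (fam_base c ∘ t) (fun R s a b => fam_graph c (t ∘ s) a b)
  _ _ _ _ _ _).
- move=> R s s' a a' b b' es ea eb; apply: fam_proper => //; by rewrite es.
- move=> R R' r s a b h.
  by apply: fam_proper (fam_natural r h); try reflexivity; rewrite comp_assoc.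
- move=> R s a b b'; exact: fam_functional.
- by move=> R s a b; rewrite -comp_assoc; apply: fam_dom.
- by move=> R s a b; rewrite -comp_assoc; apply: fam_cod.
- by move=> R s a; rewrite -comp_assoc; apply: fam_total.
Defined.

Definition fam_presheaf : presheaf C.
Proof.
refine (@Presheaf C fam fam_eq fam_res fam_eq_equiv _ _).
- move=> S T s s' c c' es [e h]; split=> /= [|R r a b cab].
    by rewrite es; apply: el_eq_comp.
  apply: h; apply: fam_proper cab; try reflexivity.
  by rewrite es.
- move=> R S T s r c; split=> /= [|Q q a b cab].
    by rewrite comp_assoc; reflexivity.
  by apply: fam_proper cab; try reflexivity; rewrite comp_assoc.
Defined.

Hypothesis full : has_dependent_full_diagrams C.

(** On the locus [T1] where the bases agree, [K] carries the generic argument, a point of [T1] with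
    an element of [A] over it. The families agree at [t] exactly when [t] factors through [T1] and
    their values [bc] and [bd] agree at all points of [K] over the factorization, which is a
    universal quantification along [K] to [T1]. *)
Lemma fam_separated : separated fam_presheaf.
Proof.
move=> T c d /=.
have [T1 [w wP]] := weakly_represented_el_eq wlim (fam_base c) (fam_base d).
have [q [q1 [q2 qP]]] := weak_products_exist wlim T1 (pX A).
have [K [k kP]] := weakly_represented_el_eq wlim
  (emor al ∘ q2) (fam_base c ∘ w ∘ q1).
have kE : emor al ∘ (q2 ∘ k) ≡ fam_base c ∘ (w ∘ (q1 ∘ k)).
  by rewrite !comp_assoc; apply/kP; exists (idm K); rewrite comp_idr.
have wE : fam_base c ∘ w ≡ fam_base d ∘ w.
  by apply/wP; exists (idm T1); rewrite comp_idr.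
have [bc hc] := fam_total kE.
have [|bd hd] := @fam_total _ d _ (w ∘ (q1 ∘ k)) (q2 ∘ k).
  transitivity (fam_base c ∘ (w ∘ (q1 ∘ k))) => //.
  by rewrite comp_assoc (comp_assoc (fam_base d)); apply: el_eq_comp.
have := weakly_represented_sub w (weakly_represented_forall wlim full (q1 ∘ k)
  (weakly_represented_el_eq wlim bc bd)).
apply: weakly_represented_iff => S t; split.
  move=> [h [et hP]]; split=> /=.
    rewrite -et !comp_assoc; exact: el_eq_comp.
  move=> R s a b cab.
  have [m [m1 m2]] := qP _ (h ∘ s) a.
  have [|n en] := (kP _ m).1.
    rewrite -!comp_assoc m1 m2 (comp_assoc w) et.
    exact: fam_dom cab.
  have e1 : w ∘ (q1 ∘ k) ∘ n ≈ t ∘ s.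
    by rewrite -!comp_assoc en m1 comp_assoc et.
  have e2 : q2 ∘ k ∘ n ≈ a by rewrite -comp_assoc en.
  have {}hP := hP _ s n; rewrite -comp_assoc en m1 in hP.
  have {}hP := hP (heq_refl _).
  apply: fam_proper (fam_natural n hd) => //; first exact: el_eq_of_heq.
  transitivity (bc ∘ n); first by symmetry.
  apply: fam_functional cab; apply: fam_proper (fam_natural n hc) => //.
    exact: el_eq_of_heq.
  reflexivity.
move=> [/= et tP]; have [h eh] := (wP _ t).1 et.
exists h; split=> // R s a ea.
have e : w ∘ (q1 ∘ k) ∘ a ≈ t ∘ s.
  by rewrite -!comp_assoc (comp_assoc q1) ea comp_assoc eh.
apply: (@fam_functional _ d R (t ∘ s) (q2 ∘ k ∘ a)).
  apply: tP; apply: fam_proper (fam_natural a hc) => //; reflexivity.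
apply: fam_proper (fam_natural a hd) => //; reflexivity.
Qed.

(** [X] classifies elements of [A] over a point of [J0], and [Y] classifies elements of [B] over a
    point of [X]. A full diagram over [y], [x] gives enough multivalued maps between
    representatives; restricting its base to the locus where these respect the relations gives the
    covering family. *)
Lemma fam_covered : covered fam_presheaf.
Proof.
pose J0 := pX J.
have [q [q1 [q2 qP]]] := weak_products_exist wlim J0 (pX A).
have [X [i iP]] := weakly_represented_el_eq wlim q1 (emor al ∘ q2).
pose x : hom X J0 := q1 ∘ i; pose ax : hom X (pX A) := q2 ∘ i.
have axE : emor al ∘ ax ≡ x.
  rewrite /ax comp_assoc; symmetry.
  by apply/iP; exists (idm X); rewrite comp_idr.
have XP (T : C) (j : hom T J0) (a : hom T (pX A)) : emor al ∘ a ≡ j ->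
    exists t : hom T X, x ∘ t ≈ j /\ ax ∘ t ≈ a.
  move=> ea; have [m [m1 m2]] := qP _ j a.
  have [|t et] := (iP _ m).1; first by rewrite -comp_assoc m1 m2; symmetry.
  by exists t; rewrite /x /ax -!comp_assoc et.
clearbody x ax.
have [q' [q1' [q2' qP']]] := weak_products_exist wlim X (pX B).
have [Y [i' iP']] := weakly_represented_el_eq wlim (x ∘ q1') (emor be ∘ q2').
pose y : hom Y X := q1' ∘ i'; pose bY : hom Y (pX B) := q2' ∘ i'.
have bYE : emor be ∘ bY ≡ x ∘ y.
  rewrite /bY /y !comp_assoc; symmetry.
  by apply/iP'; exists (idm Y); rewrite comp_idr.
have YP (T : C) (t : hom T X) (b : hom T (pX B)) : emor be ∘ b ≡ x ∘ t ->
    exists s : hom T Y, y ∘ s ≈ t /\ bY ∘ s ≈ b.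
  move=> eb; have [m [m1 m2]] := qP' _ t b.
  have [|s es] := (iP' _ m).1.
    by rewrite -!comp_assoc m1 m2; symmetry.
  by exists s; rewrite /y /bY -!comp_assoc es.
clearbody y bY.
have [D DP] := full y x.
have [eV VP] := dwpb D.
pose U := dU D; pose V := dV D; pose p1 := dp1 D; pose p2 := dp2 D.
pose f := bY ∘ df D; pose av := ax ∘ p2.
have fE : emor be ∘ f ≡ x ∘ p2.
  have eD : y ∘ df D ≈ p2 := df_over D.
  rewrite /f -eD !comp_assoc; exact: el_eq_comp.
have avE : emor al ∘ av ≡ x ∘ p2.
  by rewrite /av comp_assoc; apply: el_eq_comp.
have avP (S : C) (v : hom S V) : av ∘ v ≈ ax ∘ (p2 ∘ v) by rewrite comp_assoc.
have fP (S : C) (v : hom S V) : f ∘ v ≈ bY ∘ (df D ∘ v) by rewrite comp_assoc.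
clearbody av f.
(* On the fibres of [V] over [t], equivalent arguments have equivalent values. Since [p1] and [av]
   need not be jointly monic, this also expresses that the map is single-valued. *)
pose compat T (t : hom T U) := forall (S : C) (s : hom S T) (v v' : hom S V),
  p1 ∘ v ≈ t ∘ s -> p1 ∘ v' ≈ t ∘ s -> av ∘ v ≡ av ∘ v' -> f ∘ v ≡ f ∘ v'.
have [U0 [u0 uP]] : weakly_represented compat.
  (* [K] consists of pairs of points of [V] in one fibre with equivalent arguments; [compat] is a
     quantification along [K] to [U]. *)
  have [r [r1 [r2 rP]]] := weak_products_exist wlim V V.
  have [K [k kP]] := weakly_represented_and wlim
    (weakly_represented_heq wlim (p1 ∘ r1) (p1 ∘ r2))
    (weakly_represented_el_eq wlim (av ∘ r1) (av ∘ r2)).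
  have [kE1 kE2] : (p1 ∘ r1) ∘ k ≈ (p1 ∘ r2) ∘ k /\ (av ∘ r1) ∘ k ≡ (av ∘ r2) ∘ k.
    by apply/kP; exists (idm K); rewrite comp_idr.
  have := weakly_represented_forall wlim full (p1 ∘ r1 ∘ k)
    (weakly_represented_el_eq wlim (f ∘ r1 ∘ k) (f ∘ r2 ∘ k)).
  apply: weakly_represented_iff => T t; split=> tP.
    move=> S s v v' ev ev' eav.
    have [m [m1 m2]] := rP _ v v'.
    have [|n en] := (kP _ m).1.
      by rewrite -!comp_assoc m1 m2 ev ev'.
    have := tP _ s n; rewrite -!comp_assoc en m1 m2; exact.
  move=> S s n en; rewrite -!comp_assoc.
  apply: (tP _ s); first by rewrite !comp_assoc.
    by rewrite !comp_assoc -kE1.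
  by rewrite !comp_assoc; apply: el_eq_comp.
have u0P : compat U0 u0 by apply/uP; exists (idm U0); rewrite comp_idr.
pose graph (S : C) (s : hom S U0) (a : hom S (pX A)) (b : hom S (pX B)) :=
  exists v : hom S V, p1 ∘ v ≈ u0 ∘ s /\ av ∘ v ≡ a /\ f ∘ v ≡ b.
have base (S : C) (s : hom S U0) (v : hom S V) : p1 ∘ v ≈ u0 ∘ s ->
    x ∘ p2 ∘ v ≈ du D ∘ u0 ∘ s.
  by move=> ev; rewrite -(comp_assoc (du D)) -ev comp_assoc eV.
have @c : fam U0.
  refine (@Fam U0 (du D ∘ u0) graph _ _ _ _ _ _).
  - move=> S s s' a a' b b' es ea eb [v [v1 [v2 v3]]]; exists v; split.
      by rewrite -es.
    by split; [transitivity a | transitivity b].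
  - move=> R S r s a b [v [v1 [v2 v3]]]; exists (v ∘ r); split.
      by rewrite !comp_assoc v1.
    by rewrite !comp_assoc; split; apply: el_eq_comp.
  - move=> S s a b b' [v [v1 [v2 v3]]] [v' [v1' [v2' v3']]].
    transitivity (f ∘ v); first by symmetry.
    transitivity (f ∘ v') => //; apply: u0P v1 v1' _.
    by transitivity a => //; symmetry.
  - move=> S s a b [v [v1 [v2 v3]]].
    transitivity (emor al ∘ (av ∘ v)); first by symmetry; apply: el_eq_mor.
    rewrite -(base _ _ _ v1) comp_assoc; exact: el_eq_comp.
  - move=> S s a b [v [v1 [v2 v3]]].
    transitivity (emor be ∘ (f ∘ v)); first by symmetry; apply: el_eq_mor.
    rewrite -(base _ _ _ v1) comp_assoc; exact: el_eq_comp.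
  - move=> S s a ea; have [m [m1 m2]] := XP _ _ _ ea.
    have [|v [v1 v2]] := VP _ (u0 ∘ s) m; first by rewrite m1 comp_assoc.
    exists (f ∘ v), v; split=> //; split; last reflexivity.
    by rewrite avP v2 m2; reflexivity.
exists U0, c => T d /=.
(* The value [b'] of [d] at the generic argument over its base makes a competing diagram, to which
   fullness applies. *)
have [V' [p1' [p2' [eV' VP']]]] := weak_pullbacks_exist wlim (fam_base d) x.
have [|b' db'] := @fam_total _ d V' p1' (ax ∘ p2').
  by rewrite eV' comp_assoc; apply: el_eq_comp.
have [|f' [f1' f2']] := YP _ p2' b'.
  by rewrite -eV'; apply: fam_cod db'.
have [h [P [p [r [k [hu [[ewp wp] [/= k1 k2 k3]]]]]]]] :=
  DP (DepDiagram f1' (conj eV' VP')).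
(* The weak pullback [P] maps to [V'], so all values prescribed by [V] over [h] are values of [d].
   Functionality of [d] then makes [h] compatible. *)
have lift (S : C) (s : hom S T) (v : hom S V) : p1 ∘ v ≈ h ∘ s ->
    fam_graph d s (av ∘ v) (f ∘ v).
  move=> ev; have [w [w1 w2]] := wp _ v s ev.
  apply: fam_proper (fam_natural (k ∘ w) db').
  - by rewrite comp_assoc k1.
  - apply: el_eq_of_heq; rewrite avP -!comp_assoc (comp_assoc p2') k2.
    by rewrite -comp_assoc w1.
  - apply: el_eq_of_heq; rewrite fP -f2' -!comp_assoc (comp_assoc f') k3.
    by rewrite -comp_assoc w1.
have [|t et] := (uP _ h).1.
  move=> S s v v' ev ev' eav.
  apply: (@fam_functional _ d S s (av ∘ v)); first exact: lift.
  apply: fam_proper (lift _ _ _ ev') => //; last reflexivity.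
  by symmetry.
exists t; split=> /=; first by rewrite -comp_assoc et hu; reflexivity.
move=> S s a b [v [v1 [v2 v3]]].
apply: fam_proper (@lift S s v _) => //.
by rewrite v1 comp_assoc et.
Qed.

End FunctionPresheaf.

(** * Slices and their exponentials *)

Lemma slice_terminal (C : category) (x : C) :
  exists t : slice x, is_terminal t.
Proof.
exists (SliceObj (idm x)) => a.
have e : sarr (SliceObj (idm x)) ∘ sarr a ≈ sarr a by exact: comp_idl.
exists (SliceHom e) => g; have /= eg := smor_comm g.
by rewrite /= -eg comp_idl.
Qed.

Lemma slice_products (C : category) (x : C) : has_finite_limits C ->
  forall a b : slice x, exists (p : slice x) (p1 : hom p a) (p2 : hom p b),
    is_product p1 p2.
Proof.
move=> lim a b.
have [o [p [q [e pq]]]] := pullbacks_exist lim (sarr a) (sarr b).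
pose O := SliceObj (sarr a ∘ p).
have e2 : sarr b ∘ q ≈ sarr O by symmetry.
exists O, (@SliceHom _ _ O a p (heq_refl _)), (@SliceHom _ _ O b q e2) => t f g.
have [|h [[h1 h2] hU]] := pq _ (smor f) (smor g).
  by rewrite (smor_comm f) (smor_comm g).
have eh : sarr O ∘ h ≈ sarr t by rewrite -comp_assoc h1; exact: smor_comm.
by exists (SliceHom eh); split=> // h' e1' e2'; apply: hU.
Qed.

Section SliceExponential.
Variables (C : category) (wlim : has_weak_finite_limits C).
Variables (J : exact_completion C).

Lemma slice_hom_comm (a b : slice J) (f : hom a b) :
  emor (sarr b) ∘ emor (smor f) ≡ emor (sarr a).
Proof. exact: (smor_comm f). Qed.

Lemma slice_hom_comm_at (a b : slice J) (f : hom a b) (S : C)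
    (s : hom S (pX (sdom a))) :
  emor (sarr b) ∘ (emor (smor f) ∘ s) ≡ emor (sarr a) ∘ s.
Proof. by rewrite comp_assoc; apply: el_eq_comp; apply: slice_hom_comm. Qed.

Section Points.
Variables (z a q : slice J) (q1 : hom q z) (q2 : hom q a).
Hypothesis qP : is_product q1 q2.

(** The universal property is tested on the discrete object on [S], placed over [J] by the common
    image of [s] and [t]. *)
Lemma slice_product_point (S : C) (s : hom S (pX (sdom z)))
    (t : hom S (pX (sdom a))) :
  emor (sarr z) ∘ s ≡ emor (sarr a) ∘ t ->
  exists m : hom S (pX (sdom q)), emor (smor q1) ∘ m ≡ s /\ emor (smor q2) ∘ m ≡ t.
Proof.
move=> est.
have [j ej] := discrete_hom (emor (sarr z) ∘ s).
have [f ef] := discrete_hom s; have [g eg] := discrete_hom t.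
pose D : slice J := @SliceObj (exact_completion C) J (discrete S) j.
have fD : emor (sarr z) ∘ emor f ≡ emor (sarr D) by rewrite /= ej ef; reflexivity.
have gD : emor (sarr a) ∘ emor g ≡ emor (sarr D) by rewrite /= ej eg; symmetry.
have [h [[h1 h2] _]] := @qP D (@SliceHom (exact_completion C) J D z f fD)
  (@SliceHom (exact_completion C) J D a g gD).
exists (emor (smor h)); rewrite -ef -eg; split; [exact: h1 | exact: h2].
Qed.

Lemma slice_product_point_inj (S : C) (m m' : hom S (pX (sdom q))) :
  emor (smor q1) ∘ m ≡ emor (smor q1) ∘ m' ->
  emor (smor q2) ∘ m ≡ emor (smor q2) ∘ m' -> m ≡ m'.
Proof.
move=> e1 e2.
have [j ej] := discrete_hom (emor (sarr q) ∘ m).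
have [f ef] := discrete_hom m; have [g eg] := discrete_hom m'.
pose D : slice J := @SliceObj (exact_completion C) J (discrete S) j.
have fD : emor (sarr q) ∘ emor f ≡ emor (sarr D) by rewrite /= ej ef; reflexivity.
have gD : emor (sarr q) ∘ emor g ≡ emor (sarr D).
  rewrite /= ej eg.
  transitivity (emor (sarr z) ∘ (emor (smor q1) ∘ m')).
    by symmetry; apply: slice_hom_comm_at.
  transitivity (emor (sarr z) ∘ (emor (smor q1) ∘ m)).
    by symmetry; apply: el_eq_mor.
  exact: slice_hom_comm_at.
pose f' : @hom (slice J) D q := @SliceHom (exact_completion C) J D q f fD.
pose g' : @hom (slice J) D q := @SliceHom (exact_completion C) J D q g gD.
have [h [_ hU]] := @qP D (q1 ∘ f') (q2 ∘ f').
have hf : f' ≈ h by apply: hU; reflexivity.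
have hg : g' ≈ h.
  apply: hU.
    change (emor (smor q1) ∘ emor g ≡ emor (smor q1) ∘ emor f).
    by rewrite ef eg; symmetry.
  change (emor (smor q2) ∘ emor g ≡ emor (smor q2) ∘ emor f).
  by rewrite ef eg; symmetry.
have : emor (smor f') ≡ emor (smor g').
  by transitivity (emor (smor h)); [exact: hf | symmetry; exact: hg].
by rewrite /= ef eg.
Qed.

End Points.

Hypothesis full : has_dependent_full_diagrams C.

(** The object [E] presenting the function presheaf lies over [J] by the base of its generic family
    [g]. Evaluation is the value of [g] at the generic point of the product [p]. *)
Lemma slice_exponentials (a b : slice J) :
  exists (e p : slice J) (p1 : hom p e) (p2 : hom p a) (ev : hom p b),
    is_exponential p1 p2 ev.
Proof.
pose A := sdom a; pose al : ex_hom A J := sarr a.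
pose B := sdom b; pose be : ex_hom B J := sarr b.
have [E [g gP]] := presented wlim (fam_covered wlim al be full)
  (@fam_separated _ wlim _ _ _ al be full).
have [gC gE] := gP; rewrite /= in g gP gC gE.
have gmove (S : C) (s s' : hom S (pX E)) x y : s ≡ s' ->
    fam_graph g s x y -> fam_graph g s' x y.
  move=> es gs; have [_ h] := (gE _ _ _).2 es.
  have := h _ (idm S) x y; rewrite /=.
  move=> {}h; apply: (fam_proper _ _ _ (h _)); try reflexivity.
    by rewrite comp_idr.
  by apply: fam_proper gs; try reflexivity; rewrite comp_idr.
have [j ej] := ex_hom_of_el (generic_inv gP).1; rewrite /= in ej.
pose e : slice J := @SliceObj (exact_completion C) J E j.
have [p [p1 [p2 pP]]] := slice_products (ex_finite_limits wlim) e a.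
have p1J : fam_base g ∘ emor (smor p1) ≡ emor (sarr p).
  by rewrite -ej; apply: slice_hom_comm p1.
have [|b0 hb0] := @fam_total _ _ _ _ _ _ _ g _ (emor (smor p1)) (emor (smor p2)).
  transitivity (emor (sarr p)); first exact: slice_hom_comm.
  by symmetry.
have [|ev eev] := @ex_hom_of_el _ (sdom p) B b0.
  apply: fam_functional (fam_natural _ hb0) _.
  apply: fam_proper (gmove _ _ _ _ _ _ (fam_natural (pr2 _) hb0));
    try reflexivity; by symmetry; apply: el_eq_mor; apply: el_eq_rel.
have evP : emor (sarr b) ∘ emor ev ≡ emor (sarr p).
  rewrite eev; transitivity (fam_base g ∘ emor (smor p1)) => //.
  by apply: fam_cod hb0.
exists e, p, p1, p2, (@SliceHom (exact_completion C) J p b ev evP); split=> //.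
move=> z q q1 q2 qP f transposes.
have q1J (S : C) (m : hom S (pX (sdom q))) :=
  slice_hom_comm_at q1 m.
have q2J (S : C) (m : hom S (pX (sdom q))) :=
  slice_hom_comm_at q2 m.
have fJ (S : C) (m : hom S (pX (sdom q))) := slice_hom_comm_at f m.
(* The transpose of [f] is the family at stage [pX (sdom z)] whose graph is the image of [q] under
   [q1], [q2] and [f]. *)
pose G (S : C) (s : hom S (pX (sdom z))) (x : hom S (pX A)) (y : hom S (pX B)) :=
  exists m : hom S (pX (sdom q)), [/\ emor (smor q1) ∘ m ≡ s,
    emor (smor q2) ∘ m ≡ x & emor (smor f) ∘ m ≡ y].
have @c : fam al be (pX (sdom z)).
  refine (@Fam C A B J al be _ (emor (sarr z)) G _ _ _ _ _ _).
  - move=> S s s' x x' y y' es ex ey [m [m1 m2 m3]]; exists m; split.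
    + by rewrite -es.
    + by transitivity x.
    + by transitivity y.
  - move=> R S r s x y [m [m1 m2 m3]]; exists (m ∘ r).
    by split; rewrite comp_assoc; apply: el_eq_comp.
  - move=> S s x y y' [m [m1 m2 m3]] [m' [m1' m2' m3']].
    transitivity (emor (smor f) ∘ m); first by symmetry.
    transitivity (emor (smor f) ∘ m') => //; apply: el_eq_mor.
    apply: (slice_product_point_inj qP).
      by transitivity s => //; symmetry.
    by transitivity x => //; symmetry.
  - move=> S s x y [m [m1 m2 _]].
    transitivity (emor al ∘ (emor (smor q2) ∘ m)).
      by symmetry; apply: el_eq_mor.
    transitivity (emor (sarr z) ∘ (emor (smor q1) ∘ m)); last exact: el_eq_mor.
    transitivity (emor (sarr q) ∘ m); [exact: q2J | symmetry; exact: q1J].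
  - move=> S s x y [m [m1 _ m3]].
    transitivity (emor be ∘ (emor (smor f) ∘ m)).
      by symmetry; apply: el_eq_mor.
    transitivity (emor (sarr z) ∘ (emor (smor q1) ∘ m)); last exact: el_eq_mor.
    transitivity (emor (sarr q) ∘ m); [exact: fJ | symmetry; exact: q1J].
  - move=> S s x ex; have [|m [m1 m2]] := slice_product_point qP (s := s) (t := x).
      by symmetry.
    by exists (emor (smor f) ∘ m), m; split=> //; reflexivity.
have cb : fam_base c = emor (sarr z) by [].
have cg (S : C) (s : hom S (pX (sdom z))) x y : fam_graph c s x y <-> G S s x y.
  by split.
clearbody c.
have [h hc] := gC _ c; have [/= hc1 _] := hc; rewrite cb in hc1.
have [|h0 eh0] := @ex_hom_of_el _ (sdom z) E h.
  apply/gE; pose R := @res_proper _ (fam_presheaf al be).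
  (* The graph [G] is stated up to the relations, so restrictions of [c] along equivalent points are
     equal families; hence [h] respects the relation of [z]. *)
  have tr (s s' : hom (pR (sdom z)) (pX (sdom z))) : s ≡ s' ->
      fam_eq (fam_res (h ∘ s) g) (fam_res (h ∘ s') g).
    move=> es; have rc := @res_comp _ (fam_presheaf al be).
    have [_ sy tra] := fam_eq_equiv al be (pR (sdom z)).
    apply: (tra _ _ _); first exact: rc.
    apply: (tra _ _ _); last by apply: (sy _ _); exact: rc.
    apply: (tra _ _ _); first by exact: (R _ _ _ _ _ _ (heq_refl _) hc).
    apply: (tra _ _ _); last first.
      by apply: (sy _ _); exact: (R _ _ _ _ _ _ (heq_refl _) hc).
    split=> /= [|S t x y /cg[m [m1 m2 m3]]].
      by rewrite cb; apply: el_eq_mor.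
    apply/cg; exists m; split=> //.
    transitivity (s ∘ t) => //; exact: el_eq_comp.
  by apply: tr; apply: el_eq_rel.
have h0P : emor (sarr e) ∘ emor h0 ≡ emor (sarr z) by rewrite /= ej eh0.
pose hh : @hom (slice J) z e := @SliceHom (exact_completion C) J z e h0 h0P.
have evK (k : hom q p) : fam_graph g (emor (smor p1) ∘ emor (smor k))
    (emor (smor p2) ∘ emor (smor k)) (emor ev ∘ emor (smor k)).
  by rewrite eev; exact: fam_natural hb0.
exists hh; split.
  move=> k k1 k2; change (emor ev ∘ emor (smor k) ≡ emor (smor f)).
  have k1' : emor (smor p1) ∘ emor (smor k) ≡ h ∘ emor (smor q1).
    by rewrite -eh0; exact: k1.
  apply: fam_functional (gmove _ _ _ _ _ k1' (evK k)) _.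
  have [_ sy _] := fam_eq_equiv al be (pX (sdom z)).
  have [_ hc3] : fam_eq c (fam_res h g) by apply: (sy _ _).
  apply: fam_proper
    (hc3 _ (emor (smor q1)) (emor (smor q2)) (emor (smor f)) _) => //.
  - by symmetry; exact: k2.
  - reflexivity.
  by apply/cg; exists (idm _); split; rewrite comp_idr; reflexivity.
(* For uniqueness it suffices, by one-sided inclusion, that the graph of [g] restricted along [h']
   is contained in that of [c]. *)
move=> h' h'P; change (emor (smor h') ≡ emor h0); rewrite eh0; apply/gE.
have h'J : fam_base g ∘ emor (smor h') ≡ emor (sarr z).
  by rewrite -ej; exact: slice_hom_comm h'.
have [_ sy tra] := fam_eq_equiv al be (pX (sdom z)).
apply: (tra _ c); last exact: sy.
split=> [|S s x y gs]; first by rewrite cb.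
have [|m [m1 m2]] := slice_product_point qP (s := s) (t := x).
  transitivity (fam_base g ∘ (emor (smor h') ∘ s)).
    by rewrite comp_assoc; symmetry; apply: el_eq_comp.
  by symmetry; rewrite comp_assoc; exact: fam_dom gs.
apply/cg; exists m; split=> //.
have [k [[k1 k2] _]] := pP q ((h' : @hom (slice J) z e) ∘ q1) q2.
have ek : emor ev ∘ emor (smor k) ≡ emor (smor f) by exact: h'P k1 k2.
transitivity (emor ev ∘ emor (smor k) ∘ m).
  by symmetry; apply: el_eq_comp.
have e1 : emor (smor h') ∘ s ≡ emor (smor p1) ∘ emor (smor k) ∘ m.
  transitivity (emor (smor h') ∘ emor (smor q1) ∘ m).
    by rewrite -comp_assoc; symmetry; apply: el_eq_mor.
  by symmetry; apply: el_eq_comp; exact: k1.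
have e2 : x ≡ emor (smor p2) ∘ emor (smor k) ∘ m.
  transitivity (emor (smor q2) ∘ m); first by symmetry.
  by symmetry; apply: el_eq_comp; exact: k2.
apply: fam_functional (fam_natural m (evK k)) _.
by apply: (fam_proper _ e2 _ (gmove _ _ _ _ _ e1 gs)); reflexivity.
Qed.

End SliceExponential.

Theorem ex_locally_cartesian_closed (C : category) :
  has_weak_finite_limits C -> has_dependent_full_diagrams C ->
  locally_cartesian_closed (exact_completion C).
Proof.
move=> wlim full; split; first exact: ex_finite_limits.
move=> J; split.
- exact: slice_terminal.
- exact: slice_products (ex_finite_limits wlim).
- exact: slice_exponentials.
Qed.

(** * Model categories and their homotopy categories *)

Section ModelCategory.
Variable M : model_category.

Definition trivial_cof (a b : M) (i : hom a b) := weq _ _ i /\ cof _ _ i.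
Definition trivial_fib (a b : M) (p : hom a b) := weq _ _ p /\ fib _ _ p.

Definition lifts (a b x y : M) (i : hom a b) (p : hom x y) :=
  forall (u : hom a x) (v : hom b y), p ∘ u ≈ v ∘ i ->
    exists d : hom b x, d ∘ i ≈ u /\ p ∘ d ≈ v.

(** The retract argument; the next lemma is its dual. *)
Lemma retract_right_factor (x y z : M) (f : hom x y) (i : hom x z) (p : hom z y) :
  p ∘ i ≈ f -> lifts i f -> is_retract f p.
Proof.
move=> e l; have [|d [d1 d2]] := l (idm x) p; first by rewrite comp_idr e.
by exists i, d, (idm y), (idm y); split; rewrite ?comp_idl.
Qed.

Lemma retract_left_factor (x y z : M) (f : hom x y) (i : hom x z) (p : hom z y) :
  p ∘ i ≈ f -> lifts f p -> is_retract f i.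
Proof.
move=> e l; have [|d [d1 d2]] := l i (idm y); first by rewrite comp_idl e.
by exists (idm x), (idm x), d, p; split; rewrite ?comp_idr ?comp_idl ?e ?d1.
Qed.

Lemma fib_of_lifts (x y : M) (p : hom x y) :
  (forall (a b : M) (i : hom a b), trivial_cof i -> lifts i p) -> fib _ _ p.
Proof.
move=> l; have [z [i [q [ti fq e]]]] := @factor_tcof_fib M _ _ p.
exact: fib_retract (retract_right_factor e (l _ _ _ ti)) fq.
Qed.

Lemma cof_of_lifts (x y : M) (i : hom x y) :
  (forall (a b : M) (p : hom a b), trivial_fib p -> lifts i p) -> cof _ _ i.
Proof.
move=> l; have [z [j [q [cj tq e]]]] := @factor_cof_tfib M _ _ i.
exact: cof_retract (retract_left_factor e (l _ _ _ tq)) cj.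
Qed.

Lemma trivial_cof_of_lifts (x y : M) (i : hom x y) :
  (forall (a b : M) (p : hom a b), fib _ _ p -> lifts i p) -> trivial_cof i.
Proof.
move=> l; have [z [j [q [[wj cj] fq e]]]] := @factor_tcof_fib M _ _ i.
have r := retract_left_factor e (l _ _ _ fq).
by split; [apply: weq_retract r wj | apply: cof_retract r cj].
Qed.

Lemma weq_id (x : M) : weq _ _ (idm x).
Proof.
apply: (proj1 (trivial_cof_of_lifts _)) => a b p _ u v e; exists u.
by rewrite comp_idr e comp_idr.
Qed.

Lemma fib_pullback (x y z o : M) (f : hom x z) (g : hom y z)
    (p : hom o x) (q : hom o y) : is_pullback f g p q ->
  fib _ _ f -> fib _ _ q.
Proof.
move=> pb ff; have [e pq] := pb; apply: fib_of_lifts => a b i ti u v euv.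
have [|d [d1 d2]] := lift_tcof_fib ti ff (u := p ∘ u) (v := g ∘ v).
  by rewrite comp_assoc e -!comp_assoc euv.
have [h [[h1 h2] _]] := pq _ d v d2.
exists h; split=> //; apply: (pullback_ext pb); rewrite comp_assoc.
  by rewrite h1 d1.
by rewrite h2 euv.
Qed.

Lemma retraction_weq (x z : M) (i : hom x z) (s : hom z x) :
  s ∘ i ≈ idm x -> weq _ _ i -> weq _ _ s.
Proof.
move=> e wi; have [_ h _] := weq_2of3 i s; apply: h => //.
exact: weq_heq (symmetry e) (weq_id x).
Qed.

Lemma section_weq (x z : M) (i : hom x z) (s : hom z x) :
  s ∘ i ≈ idm x -> weq _ _ s -> weq _ _ i.
Proof.
move=> e ws; have [_ _ h] := weq_2of3 i s; apply: h => //.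
exact: weq_heq (symmetry e) (weq_id x).
Qed.

(** The lifting property of the map to a terminal object, stated without choosing one. *)
Definition fibrant (Y : M) := forall (a b : M) (i : hom a b), trivial_cof i ->
  forall u : hom a Y, exists d : hom b Y, d ∘ i ≈ u.

Lemma fibrant_fib (E B : M) (p : hom E B) : fib _ _ p -> fibrant B -> fibrant E.
Proof.
move=> fp fB a b i ti u; have [v ev] := fB _ _ _ ti (p ∘ u).
by have [d [ed _]] := lift_tcof_fib ti fp (symmetry ev); exists d.
Qed.

Lemma fibrant_terminal (t : M) : is_terminal t -> fibrant t.
Proof.
move=> tP a b i _ u; have [d _] := tP b; have [f fP] := tP a.
by exists d; rewrite (fP u) (fP (d ∘ i)).
Qed.

Lemma fibrant_replacement (X : M) :
  exists (Y : M) (w : hom X Y), fibrant Y /\ trivial_cof w.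
Proof.
have [t tP] := terminal_exists (@model_limits M); have [f _] := tP X.
have [Y [w [p [tw fp _]]]] := factor_tcof_fib f.
exists Y, w; split=> //; exact: fibrant_fib fp (fibrant_terminal tP).
Qed.

(** The last clause says that the pair [d0], [d1] is a fibration to the product of [Y] with itself,
    in terms of lifting. *)
Definition path_object (Y P : M) (s : hom Y P) (d0 d1 : hom P Y) :=
  [/\ d0 ∘ s ≈ idm Y, d1 ∘ s ≈ idm Y, weq _ _ s, trivial_fib d0
    & forall (a b : M) (i : hom a b), trivial_cof i ->
      forall (u : hom a P) (v0 v1 : hom b Y), d0 ∘ u ≈ v0 ∘ i -> d1 ∘ u ≈ v1 ∘ i ->
      exists d : hom b P, [/\ d ∘ i ≈ u, d0 ∘ d ≈ v0 & d1 ∘ d ≈ v1]].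

Lemma path_object_exists (Y : M) : fibrant Y ->
  exists (P : M) (s : hom Y P) (d0 d1 : hom P Y), path_object s d0 d1.
Proof.
move=> fY; have [q [q1 [q2 qP]]] := products_exist (@model_limits M) Y Y.
have [D [[D1 D2] _]] := qP _ (idm Y) (idm Y).
have [P [s [p [ts fp e]]]] := factor_tcof_fib D.
have joint (a b : M) (i : hom a b) : trivial_cof i ->
    forall (u : hom a P) (v0 v1 : hom b Y),
    (q1 ∘ p) ∘ u ≈ v0 ∘ i -> (q2 ∘ p) ∘ u ≈ v1 ∘ i ->
    exists d : hom b P, [/\ d ∘ i ≈ u, (q1 ∘ p) ∘ d ≈ v0 & (q2 ∘ p) ∘ d ≈ v1].
  move=> ti u v0 v1 e0 e1; have [v [[v0' v1'] _]] := qP _ v0 v1.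
  have [|d [d0 d1]] := lift_tcof_fib ti fp (u := u) (v := v).
    have [h [_ hU]] := qP _ (v0 ∘ i) (v1 ∘ i).
    rewrite (hU (p ∘ u)) ?comp_assoc // (hU (v ∘ i)) // comp_assoc.
      by rewrite v0'.
    by rewrite v1'.
  by exists d; split=> //; rewrite -comp_assoc d1.
have e1 : (q1 ∘ p) ∘ s ≈ idm Y by rewrite -comp_assoc e.
have e2 : (q2 ∘ p) ∘ s ≈ idm Y by rewrite -comp_assoc e.
exists P, s, (q1 ∘ p), (q2 ∘ p); split=> //; first exact: ts.1.
split; first exact: retraction_weq e1 ts.1.
(* A lift against [d0] alone reduces to the joint lift, once fibrancy of [Y] extends the other
   endpoint along [i]. *)
apply: fib_of_lifts => a b i ti u v0 e0.
have [v1 ev1] := fY _ _ _ ti ((q2 ∘ p) ∘ u).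
have [d [d0 d1 _]] := joint _ _ _ ti u v0 v1 e0 (symmetry ev1).
by exists d.
Qed.

(** * Cylinders and homotopies when all objects are cofibrant *)

Hypothesis all_cofibrant : forall x : M, cofibrant x.

Lemma cofibrant_lift (E B X : M) (p : hom E B) (v : hom X B) :
  trivial_fib p -> exists d : hom X E, p ∘ d ≈ v.
Proof.
move=> tp; have [o oP] := terminal_exists (@model_colimits M).
have iP : is_initial (o : M) by exact: oP.
have [f _] := iP X; have [g _] := iP E; have [k kP] := iP B.
have [|d [_ ed]] := lift_cof_tfib (@all_cofibrant _ _ f iP) tp (u := g) (v := v).
  by rewrite (kP (p ∘ g)) (kP (v ∘ f)).
by exists d.
Qed.

Lemma coproducts_exist (a b : M) :
  exists (c : M) (i1 : hom a c) (i2 : hom b c), cof _ _ i1 /\ cof _ _ i2 /\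
  forall (t : M) (f : hom a t) (g : hom b t),
    exists h : hom c t, (h ∘ i1 ≈ f /\ h ∘ i2 ≈ g) /\
      forall h' : hom c t, h' ∘ i1 ≈ f -> h' ∘ i2 ≈ g -> h' ≈ h.
Proof.
have [c [i1 [i2 cP]]] : exists (c : M) (i1 : hom a c) (i2 : hom b c),
    forall (t : M) (f : hom a t) (g : hom b t),
    exists h : hom c t, (h ∘ i1 ≈ f /\ h ∘ i2 ≈ g) /\
      forall h' : hom c t, h' ∘ i1 ≈ f -> h' ∘ i2 ≈ g -> h' ≈ h.
  exact: (@products_exist (opposite M) (@model_colimits M) a b).
exists c, i1, i2.
have cE (t : M) (h h' : hom c t) : h ∘ i1 ≈ h' ∘ i1 -> h ∘ i2 ≈ h' ∘ i2 -> h ≈ h'.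
  move=> e1 e2; have [k [_ kU]] := cP t (h ∘ i1) (h ∘ i2).
  have E1 : h ≈ k by apply: kU.
  have E2 : h' ≈ k by apply: kU; symmetry.
  by rewrite E1 E2.
split; [|split=> //]; apply: cof_of_lifts => x y p tp u v e.
  have [d2 ed2] := @cofibrant_lift _ _ b p (v ∘ i2) tp.
  have [d [[h1 h2] _]] := cP x u d2; exists d; split=> //.
  by apply: cE; rewrite -comp_assoc ?h1 ?h2.
have [d1 ed1] := @cofibrant_lift _ _ a p (v ∘ i1) tp.
have [d [[h1 h2] _]] := cP x d1 u; exists d; split=> //.
by apply: cE; rewrite -comp_assoc ?h1 ?h2.
Qed.

Lemma cof_comp (x y z : M) (f : hom x y) (g : hom y z) :
  cof _ _ f -> cof _ _ g -> cof _ _ (g ∘ f).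
Proof.
move=> cf cg; apply: cof_of_lifts => a b p tp u v e.
have [|d [d1 d2]] := lift_cof_tfib cf tp (u := u) (v := v ∘ g).
  by rewrite -comp_assoc.
have [d' [d1' d2']] := lift_cof_tfib cg tp d2.
by exists d'; rewrite comp_assoc d1'.
Qed.

(** Dually to [path_object], the last clause says that [i0] and [i1] jointly form a cofibration from
    the coproduct of [X] with itself. *)
Definition cylinder (X Z : M) (i0 i1 : hom X Z) (s : hom Z X) :=
  [/\ s ∘ i0 ≈ idm X, s ∘ i1 ≈ idm X, trivial_cof i0, trivial_cof i1
    & forall (E B : M) (p : hom E B), trivial_fib p ->
      forall (u0 u1 : hom X E) (v : hom Z B), p ∘ u0 ≈ v ∘ i0 -> p ∘ u1 ≈ v ∘ i1 ->
      exists d : hom Z E, [/\ d ∘ i0 ≈ u0, d ∘ i1 ≈ u1 & p ∘ d ≈ v]].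

Lemma cylinder_exists (X : M) :
  exists (Z : M) (i0 i1 : hom X Z) (s : hom Z X), cylinder i0 i1 s.
Proof.
have [c [j0 [j1 [cj0 [cj1 cP]]]]] := coproducts_exist X X.
have [D [[D0 D1] _]] := cP _ (idm X) (idm X).
have [Z [i [s [ci ts e]]]] := factor_cof_tfib D.
have e0 : s ∘ (i ∘ j0) ≈ idm X by rewrite comp_assoc e.
have e1 : s ∘ (i ∘ j1) ≈ idm X by rewrite comp_assoc e.
exists Z, (i ∘ j0), (i ∘ j1), s; split=> //.
- by split; [apply: section_weq e0 ts.1 | apply: cof_comp].
- by split; [apply: section_weq e1 ts.1 | apply: cof_comp].
move=> E B p tp u0 u1 v h0 h1; have [u [[eu0 eu1] _]] := cP _ u0 u1.
have [|d [d1 d2]] := lift_cof_tfib ci tp (u := u) (v := v).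
  have [h [_ hU]] := cP _ (p ∘ u0) (p ∘ u1).
  rewrite (hU (p ∘ u)) -?comp_assoc ?eu0 ?eu1 //.
  by rewrite (hU (v ∘ i)) -?comp_assoc ?h0 ?h1.
by exists d; split=> //; rewrite comp_assoc d1.
Qed.

Lemma cylinder_sym (X Z : M) (i0 i1 : hom X Z) (s : hom Z X) :
  cylinder i0 i1 s -> cylinder i1 i0 s.
Proof.
move=> [e0 e1 t0 t1 l]; split=> // E B p tp u0 u1 v h0 h1.
by have [d [d0 d1 d2]] := l _ _ _ tp u1 u0 v h1 h0; exists d.
Qed.

Definition homotopic (X Y : M) (f g : hom X Y) :=
  exists (P : M) (s : hom Y P) (d0 d1 : hom P Y) (k : hom X P),
    [/\ path_object s d0 d1, d0 ∘ k ≈ f & d1 ∘ k ≈ g].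

(** Lifting against the trivial fibration [d0] joins the constant homotopy at [f] to [k] across the
    cylinder; its image under [d1] runs from [f] to [g]. *)
Lemma homotopic_cylinder (X Y Z : M) (f g : hom X Y) (i0 i1 : hom X Z)
    (s : hom Z X) : homotopic f g -> cylinder i0 i1 s ->
  exists H : hom Z Y, H ∘ i0 ≈ f /\ H ∘ i1 ≈ g.
Proof.
move=> [P [c [d0 [d1 [k [[e0 e1 _ td0 _] k0 k1]]]]]] [s0 s1 _ _ l].
have [||d [h0 h1 h2]] := l _ _ _ td0 (c ∘ f) k (f ∘ s).
- by rewrite comp_assoc e0 -comp_assoc s0 comp_idl comp_idr.
- by rewrite k0 -comp_assoc s1 comp_idr.
exists (d1 ∘ d); split; rewrite -comp_assoc ?h0 ?h1 //.
by rewrite comp_assoc e1 comp_idl.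
Qed.

(* Concatenates a right homotopy with a left one.  This single lift gives
   symmetry, transitivity and independence of the path object. *)
Lemma path_object_cylinder (X Y P Z : M) (f g h : hom X Y) (c : hom Y P)
    (d0 d1 : hom P Y) (i0 i1 : hom X Z) (s : hom Z X) (k : hom X P) (H : hom Z Y) :
  path_object c d0 d1 -> cylinder i0 i1 s ->
  d0 ∘ k ≈ f -> d1 ∘ k ≈ g -> H ∘ i0 ≈ g -> H ∘ i1 ≈ h ->
  exists k' : hom X P, d0 ∘ k' ≈ f /\ d1 ∘ k' ≈ h.
Proof.
move=> [_ _ _ _ l] [s0 s1 t0 _ _] k0 k1 H0 H1.
have [||d [h0 h1 h2]] := l _ _ _ t0 k (f ∘ s) H.
- by rewrite k0 -comp_assoc s0 comp_idr.
- by rewrite k1 H0.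
exists (d ∘ i1); rewrite !comp_assoc h1 h2 -comp_assoc s1 comp_idr.
by split.
Qed.

Lemma homotopic_path_object (X Y P : M) (f g : hom X Y) (c : hom Y P)
    (d0 d1 : hom P Y) : homotopic f g -> path_object c d0 d1 ->
  exists k : hom X P, d0 ∘ k ≈ f /\ d1 ∘ k ≈ g.
Proof.
move=> fg PP; have [Z [i0 [i1 [s ZP]]]] := cylinder_exists X.
have [H [H0 H1]] := homotopic_cylinder fg ZP.
have [e0 e1 _ _ _] := PP.
by apply: (path_object_cylinder PP ZP (k := c ∘ f) _ _ H0 H1);
  rewrite comp_assoc ?e0 ?e1 comp_idl.
Qed.

Lemma homotopic_refl (X Y : M) (f g : hom X Y) : fibrant Y -> f ≈ g -> homotopic f g.
Proof.
move=> /path_object_exists[P [c [d0 [d1 PP]]]] e; have [e0 e1 _ _ _] := PP.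
by exists P, c, d0, d1, (c ∘ f); split=> //; rewrite comp_assoc ?e0 ?e1 comp_idl.
Qed.

Lemma homotopic_sym (X Y : M) (f g : hom X Y) : homotopic f g -> homotopic g f.
Proof.
move=> fg; have [P [c [d0 [d1 [_ [PP _ _]]]]]] := fg; have [e0 e1 _ _ _] := PP.
have [Z [i0 [i1 [s ZP]]]] := cylinder_exists X.
have [H [H0 H1]] := homotopic_cylinder fg ZP.
have c0 : d0 ∘ (c ∘ g) ≈ g by rewrite comp_assoc e0 comp_idl.
have c1 : d1 ∘ (c ∘ g) ≈ g by rewrite comp_assoc e1 comp_idl.
have [k [k0 k1]] := path_object_cylinder PP (cylinder_sym ZP) c0 c1 H1 H0.
by exists P, c, d0, d1, k.
Qed.

Lemma homotopic_trans (X Y : M) (f g h : hom X Y) :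
  homotopic f g -> homotopic g h -> homotopic f h.
Proof.
move=> [P [c [d0 [d1 [k [PP k0 k1]]]]]] gh.
have [Z [i0 [i1 [s ZP]]]] := cylinder_exists X.
have [H [H0 H1]] := homotopic_cylinder gh ZP.
have [k' [k0' k1']] := path_object_cylinder PP ZP k0 k1 H0 H1.
by exists P, c, d0, d1, k'.
Qed.

Lemma homotopic_precomp (X X' Y : M) (f g : hom X Y) (a : hom X' X) :
  homotopic f g -> homotopic (f ∘ a) (g ∘ a).
Proof.
move=> [P [c [d0 [d1 [k [PP k0 k1]]]]]]; exists P, c, d0, d1, (k ∘ a).
by split=> //; rewrite comp_assoc ?k0 ?k1.
Qed.

#[local] Instance homotopic_proper (X Y : M) :
  Proper (heq ==> heq ==> iff) (@homotopic X Y).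
Proof.
move=> f f' ef g g' eg; split=> -[P [c [d0 [d1 [k [PP k0 k1]]]]]];
  exists P, c, d0, d1, k; split=> //; by rewrite ?k0 ?k1 ?ef ?eg.
Qed.

Lemma trivial_cof_homotopic_inj (A B Y : M) (i : hom A B) (f g : hom B Y) :
  trivial_cof i -> homotopic (f ∘ i) (g ∘ i) -> homotopic f g.
Proof.
move=> ti [P [c [d0 [d1 [k [PP k0 k1]]]]]]; have [_ _ _ _ l] := PP.
have [d [_ h0 h1]] := l _ _ _ ti k f g k0 k1.
by exists P, c, d0, d1, d.
Qed.

(* Ken Brown's factorization: a weak equivalence between cofibrant objects is
   [q ∘ i] with [i] a trivial cofibration and [q] a retraction of another. *)
Lemma ken_brown (A B : M) (w : hom A B) : weq _ _ w ->
  exists (Z : M) (i : hom A Z) (j : hom B Z) (q : hom Z B),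
    [/\ trivial_cof i, trivial_cof j, q ∘ i ≈ w & q ∘ j ≈ idm B].
Proof.
move=> ww; have [c [j1 [j2 [c1 [c2 cP]]]]] := coproducts_exist A B.
have [D [[D1 D2] _]] := cP _ w (idm B).
have [Z [k [q [ck [wq _] e]]]] := factor_cof_tfib D.
have e1 : q ∘ (k ∘ j1) ≈ w by rewrite comp_assoc e.
have e2 : q ∘ (k ∘ j2) ≈ idm B by rewrite comp_assoc e.
exists Z, (k ∘ j1), (k ∘ j2), q; split=> //; split; try exact: cof_comp.
- have [_ _ h] := weq_2of3 (k ∘ j1) q; apply: h => //.
  exact: weq_heq (symmetry e1) ww.
- exact: section_weq e2 wq.
Qed.

Lemma weq_homotopic_inj (A B Y : M) (w : hom A B) (f g : hom B Y) :
  weq _ _ w -> homotopic (f ∘ w) (g ∘ w) -> homotopic f g.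
Proof.
move=> /ken_brown[Z [i [j [q [ti tj e1 e2]]]]] h.
have : homotopic (f ∘ q) (g ∘ q).
  by apply: (trivial_cof_homotopic_inj ti); rewrite -!comp_assoc e1.
by move=> /(homotopic_precomp j); rewrite -!comp_assoc e2 !comp_idr.
Qed.

Lemma weq_homotopic_surj (A B Y : M) (w : hom A B) (f : hom A Y) :
  fibrant Y -> weq _ _ w -> exists g : hom B Y, homotopic (g ∘ w) f.
Proof.
move=> fY /ken_brown[Z [i [j [q [ti tj e1 e2]]]]].
have [g eg] := fY _ _ _ ti f; exists (g ∘ j).
have : homotopic (g ∘ j ∘ q) g.
  apply: (trivial_cof_homotopic_inj tj); apply: homotopic_refl => //.
  by rewrite -comp_assoc e2 comp_idr.
by move=> /(homotopic_precomp i); rewrite -comp_assoc e1 eg.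
Qed.

(** The covering homotopy property: [e] moves along a cylinder to an arrow strictly over [b]. Both
    ends coincide in the homotopy category by [loc_cylinder]. *)
Lemma homotopy_lifting (E B X : M) (p : hom E B) (e : hom X E) (b : hom X B) :
  fib _ _ p -> homotopic (p ∘ e) b ->
  exists (Z : M) (i0 i1 : hom X Z) (s : hom Z X) (H : hom Z E),
    [/\ cylinder i0 i1 s, H ∘ i0 ≈ e & p ∘ (H ∘ i1) ≈ b].
Proof.
move=> fp h; have [Z [i0 [i1 [s ZP]]]] := cylinder_exists X.
have [H [H0 H1]] := homotopic_cylinder h ZP; have [_ _ t0 _ _] := ZP.
have [K [K0 K1]] := lift_tcof_fib t0 fp (symmetry H0).
by exists Z, i0, i1, s, K; split=> //; rewrite comp_assoc K1.
Qed.

End ModelCategory.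

#[local] Existing Instance homotopic_proper.

(** * Arrows of the localization into fibrant objects *)

Section HomotopyCategory.
Variable M : model_category.
Notation Ho := (homotopy_category M).

Definition loc (x y : M) (f : hom x y) : @hom Ho x y := loc_arr (@weq M) f.

#[local] Instance loc_proper (x y : M) : Proper (heq ==> heq) (@loc x y).
Proof. by move=> f g; apply: loc_arr_congr. Qed.

Lemma loc_of_comp (x y z : M) (g : hom y z) (f : hom x y) :
  loc (g ∘ f) ≈ loc g ∘ loc f.
Proof. exact: loc_arr_comp. Qed.

Lemma loc_id (x : M) : loc (idm x) ≈ idm (x : Ho).
Proof. exact: loc_refl. Qed.

Lemma loc_weq_inverse (x y : M) (w : hom x y) : weq _ _ w ->
  exists v : @hom Ho y x, v ∘ loc w ≈ idm _ /\ loc w ∘ v ≈ idm _.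
Proof.
by move=> ww; exists (loc_inv ww); split; [apply: loc_invl | apply: loc_invr].
Qed.

Lemma loc_weq_mono (x y : M) (w : hom x y) (t : Ho) (a b : @hom Ho t x) :
  weq _ _ w -> loc w ∘ a ≈ loc w ∘ b -> a ≈ b.
Proof.
move=> /loc_weq_inverse[v [e _]] ab.
by rewrite -(comp_idl a) -(comp_idl b) -e -!comp_assoc ab.
Qed.

Lemma loc_weq_epi (x y : M) (w : hom x y) (t : Ho) (a b : @hom Ho y t) :
  weq _ _ w -> a ∘ loc w ≈ b ∘ loc w -> a ≈ b.
Proof.
move=> /loc_weq_inverse[v [_ e]] ab.
by rewrite -(comp_idr a) -(comp_idr b) -e !comp_assoc ab.
Qed.

Lemma loc_retractions (x z : M) (i0 i1 : hom x z) (s : hom z x) :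
  s ∘ i0 ≈ idm x -> s ∘ i1 ≈ idm x -> weq _ _ i0 -> loc i0 ≈ loc i1.
Proof.
move=> e0 e1 wi; apply: (loc_weq_mono (retraction_weq e0 wi)).
by rewrite -!loc_of_comp e0 e1.
Qed.

Lemma loc_cylinder (x z : M) (i0 i1 : hom x z) (s : hom z x) :
  cylinder i0 i1 s -> loc i0 ≈ loc i1.
Proof. by move=> [e0 e1 [wi _] _ _]; apply: (loc_retractions e0 e1). Qed.

Lemma loc_path_object (y p : M) (s : hom y p) (d0 d1 : hom p y) :
  path_object s d0 d1 -> loc d0 ≈ loc d1.
Proof.
move=> [e0 e1 ws _ _]; apply: (loc_weq_epi ws).
by rewrite -!loc_of_comp e0 e1.
Qed.

Lemma loc_homotopic (x y : M) (f g : hom x y) : homotopic f g -> loc f ≈ loc g.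
Proof.
move=> [p [s [d0 [d1 [k [pp e0 e1]]]]]].
by rewrite -e0 -e1 !loc_of_comp (loc_path_object pp).
Qed.

Hypothesis all_cofibrant : forall x : M, cofibrant x.

(* The presheaf of homotopy classes of maps into [Y] inverts weak equivalences;
   this is the induced action of the arrows of the localization, as a relation
   between representatives. *)
Fixpoint act (Y x y : M) (f : loc_hom (@weq M) x y) : hom y Y -> hom x Y -> Prop :=
  match f in loc_hom _ x y return hom y Y -> hom x Y -> Prop with
  | loc_arr _ _ a => fun g h => homotopic (g ∘ a) h
  | loc_inv _ _ w _ => fun g h => homotopic (h ∘ w) g
  | loc_comp _ _ _ b a => fun g h => exists m, act b g m /\ act a m h
  end.

Section Action.
Variables (Y : M) (fY : fibrant Y).

Lemma act_homotopic (x y : M) (f : loc_hom (@weq M) x y) (g g' : hom y Y) h h' :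
  homotopic g g' -> homotopic h h' -> act f g h -> act f g' h'.
Proof.
elim: f g g' h h' => [{}x {}y a|{}x {}y w ww|{}x {}y z b IHb a IHa];
  move=> g g' h h' eg eh /=.
- move=> e; apply: homotopic_trans eh => //.
  apply: homotopic_trans e => //.
  by apply: homotopic_precomp; apply: homotopic_sym.
- move=> e; apply: homotopic_trans eg => //.
  apply: homotopic_trans e => //.
  by apply: homotopic_precomp; apply: homotopic_sym.
- move=> [m [e1 e2]]; exists m; split.
    by apply: IHb e1 => //; apply: homotopic_refl.
  by apply: IHa e2 => //; apply: homotopic_refl.
Qed.

Lemma act_total (x y : M) (f : loc_hom (@weq M) x y) (g : hom y Y) :
  exists h, act f g h.
Proof.
elim: f g => [{}x {}y a|{}x {}y w ww|{}x {}y z b IHb a IHa] g /=.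
- by exists (g ∘ a); apply: homotopic_refl.
- exact: weq_homotopic_surj.
- have [m e1] := IHb g; have [h e2] := IHa m.
  by exists h, m.
Qed.

(** The relations for formal inverses hold because precomposition with a weak equivalence is
    bijective on homotopy classes into [Y]; the other cases are formal. *)
Lemma act_loc_heq (x y : M) (f f' : loc_hom (@weq M) x y) : loc_heq f f' ->
  forall (g : hom y Y) h, act f g h <-> act f' g h.
Proof.
have R (u : M) (g : hom u Y) : homotopic g g by apply: homotopic_refl.
elim=> {x y f f'} /=.
- by [].
- by move=> x y f g _ IH k h; rewrite IH.
- by move=> x y f g h _ IH1 _ IH2 k l; rewrite IH1 IH2.
- move=> x y z g g' f f' _ IHg _ IHf k h.
  by split=> -[m [e1 e2]]; exists m; split;
    [apply/IHg | apply/IHf | apply/IHg | apply/IHf].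
- move=> x y f g h; split=> [[m []]|e].
    by rewrite comp_idr => e; apply: act_homotopic => //; apply: homotopic_sym.
  by exists g; rewrite comp_idr.
- move=> x y f g h; split=> [[m [e]]|e].
    by rewrite comp_idr => e'; apply: act_homotopic e.
  by exists h; rewrite comp_idr.
- move=> x y z w h g f k l; split=> [[m [e1 [n [e2 e3]]]]|[m [[n [e1 e2]] e3]]].
    by exists n; split=> //; exists m.
  by exists n; split=> //; exists m.
- by move=> x y f g e k h; rewrite e.
- move=> x y z g f k h; split=> [e|[m [e1 e2]]].
    by exists (k ∘ g); split=> //; rewrite -comp_assoc.
  apply: homotopic_trans e2 => //; rewrite comp_assoc.
  exact: homotopic_precomp.
- move=> x y w ww g h; rewrite comp_idr; split=> [[m [e1 e2]]|e].
    by apply: homotopic_trans e2 => //; apply: homotopic_sym.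
  have [m em] := weq_homotopic_surj all_cofibrant g fY ww.
  by exists m; split=> //; apply: homotopic_trans em e.
- move=> x y w ww g h; rewrite comp_idr; split=> [[m [e1 e2]]|e].
    apply: (weq_homotopic_inj all_cofibrant ww).
    by apply: homotopic_trans e1 _ => //; apply: homotopic_sym.
  exists (g ∘ w); split=> //; apply: homotopic_precomp.
  exact: homotopic_sym.
Qed.

Lemma act_loc (x y : M) (f : loc_hom (@weq M) x y) (g : hom y Y) h :
  act f g h -> loc g ∘ (f : @hom Ho x y) ≈ loc h.
Proof.
elim: f g h => [{}x {}y a|{}x {}y w ww|{}x {}y z b IHb a IHa] g h.
- move=> e; change (loc g ∘ loc a ≈ loc h).
  by rewrite -loc_of_comp; apply: loc_homotopic e.
- move=> e; apply: (loc_weq_epi ww).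
  rewrite -loc_of_comp (loc_homotopic e) -comp_assoc.
  have -> : (loc_inv ww : @hom Ho y x) ∘ loc w ≈ idm _ by apply: loc_invl.
  exact: comp_idr.
- move=> [m [e1 e2]].
  change (loc g ∘ ((b : @hom Ho y z) ∘ (a : @hom Ho x y)) ≈ loc h).
  by rewrite comp_assoc (IHb _ _ e1) (IHa _ _ e2).
Qed.

(** As in the Yoneda lemma, the representative is the action of [f] on the identity of [Y];
    [loc_faithful] uses the same device. *)
Lemma loc_full (x : M) (f : @hom Ho x Y) : exists g : hom x Y, f ≈ loc g.
Proof.
have [g e] := act_total f (idm Y); exists g.
by rewrite -(act_loc e) loc_id comp_idl.
Qed.

Lemma loc_faithful (x : M) (f g : hom x Y) : loc f ≈ loc g -> homotopic f g.
Proof.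
move=> /act_loc_heq/(_ (idm Y) g)/= h; rewrite !comp_idl in h.
by apply/h; apply: homotopic_refl.
Qed.

End Action.

End HomotopyCategory.

#[local] Existing Instance loc_proper.

(** * Invariance of dependent full diagrams under isomorphism *)

Section Transport.
Variables (C : category) (Y X J Y' X' J' : C).
Variables (y : hom Y X) (x : hom X J) (y' : hom Y' X') (x' : hom X' J').

Definition dep_transport (e : hom Y Y') (k : hom X X') (i : hom J J')
    (k' : hom X' X) (i' : hom J' J)
    (ey : y' ∘ e ≈ k ∘ y) (ex : x' ∘ k ≈ i ∘ x) (ex' : x ∘ k' ≈ i' ∘ x')
    (ek : k ∘ k' ≈ idm X') (ei : i' ∘ i ≈ idm J) (D : dep_diagram y x) :
  dep_diagram y' x'.
Proof.
refine (@DepDiagram C Y' X' J' y' x' (dU D) (dV D) (i ∘ du D) (dp1 D)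
  (k ∘ dp2 D) (e ∘ df D) _ _).
- by rewrite comp_assoc ey -comp_assoc df_over.
- have [eD pD] := dwpb D; split.
    by rewrite -comp_assoc eD !comp_assoc ex.
  move=> t a b eab.
  have [|h [h1 h2]] := pD t a (k' ∘ b).
    by rewrite comp_assoc ex' -comp_assoc -eab !comp_assoc ei comp_idl.
  by exists h; rewrite h1 -comp_assoc h2 comp_assoc ek comp_idl.
Defined.

End Transport.

Lemma dependent_full_iso (C : category) (Y X J Y' X' J' : C)
    (y : hom Y X) (x : hom X J) (y' : hom Y' X') (x' : hom X' J')
    (e : hom Y Y') (k : hom X X') (i : hom J J')
    (e' : hom Y' Y) (k' : hom X' X) (i' : hom J' J) :
  e ∘ e' ≈ idm Y' -> e' ∘ e ≈ idm Y -> k ∘ k' ≈ idm X' -> k' ∘ k ≈ idm X ->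
  i ∘ i' ≈ idm J' -> i' ∘ i ≈ idm J ->
  y ∘ e' ≈ k' ∘ y' -> x ∘ k' ≈ i' ∘ x' ->
  (exists D : dep_diagram y x, is_dependent_full D) ->
  exists D : dep_diagram y' x', is_dependent_full D.
Proof.
move=> ee ee' kk kk' ii ii' ey' ex' [D DP].
have ey : y' ∘ e ≈ k ∘ y.
  by rewrite -(comp_idl (y' ∘ e)) -kk -comp_assoc (comp_assoc k') -ey'
    -(comp_assoc y) ee' comp_idr.
have ex : x' ∘ k ≈ i ∘ x.
  by rewrite -(comp_idl (x' ∘ k)) -ii -comp_assoc (comp_assoc i') -ex'
    -(comp_assoc x) kk' comp_idr.
exists (dep_transport ey ex ex' kk ii' D) => D'.
have [h [P [q [r [a [uh [wp [/= a1 a2 a3]]]]]]]] :=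
  DP (dep_transport ey' ex' ex kk' ii D').
exists h, P, q, r, a => /=; split.
  by rewrite -comp_assoc uh comp_assoc ii comp_idl.
split=> //; split=> //.
  by rewrite -comp_assoc -a2 !comp_assoc kk comp_idl.
by rewrite -comp_assoc -a3 !comp_assoc ee comp_idl.
Qed.

(** * Weak limits and dependent full diagrams in the homotopy category *)

Section HomotopyCategoryLimits.
Variable M : model_category.
Notation Ho := (homotopy_category M).
Hypothesis all_cofibrant : forall x : M, cofibrant x.

Lemma model_weak_limits : has_weak_finite_limits M.
Proof.
move=> D; have [L LP] := @model_limits M D; exists L => K.
by have [h [hK _]] := LP K; exists h.
Qed.

Lemma ho_weak_finite_limits : has_weak_finite_limits Ho.
Proof.
apply/weak_basic_limits; split.
- have [t tP] := terminal_exists (@model_limits M); exists (t : M) => x.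
  by have [f _] := tP x; exists (loc f).
- move=> a b.
  have [a' [wa [fa [/loc_weq_inverse[va [va1 va2]] _]]]] := fibrant_replacement a.
  have [b' [wb [fb [/loc_weq_inverse[vb [vb1 vb2]] _]]]] := fibrant_replacement b.
  have [p [p1 [p2 pP]]] := products_exist (@model_limits M) a' b'.
  exists p, (va ∘ loc p1), (vb ∘ loc p2) => t f g.
  have [f0 ef] := loc_full all_cofibrant fa (loc wa ∘ f).
  have [g0 eg] := loc_full all_cofibrant fb (loc wb ∘ g).
  have [h [[h1 h2] _]] := pP _ f0 g0.
  exists (loc h); split=> //.
  rewrite -!comp_assoc -!loc_of_comp h1 h2 -ef -eg !comp_assoc va1 vb1 !comp_idl.
  by split.
- move=> a b f g.
  have [a' [wa [fa [/loc_weq_inverse[va [va1 va2]] _]]]] := fibrant_replacement a.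
  have [b' [wb [fb [ww _]]]] := fibrant_replacement b.
  have [f0 ef] := loc_full all_cofibrant fb (loc wb ∘ f ∘ va).
  have [g0 eg] := loc_full all_cofibrant fb (loc wb ∘ g ∘ va).
  (* The weak equalizer is a homotopy equalizer: [L] classifies an arrow [e] together with a
     homotopy from [f0 ∘ e] to [g0 ∘ e]. *)
  have [P [s [d0 [d1 PP]]]] := path_object_exists fb.
  have [L [e [k [[k0 k1] LP]]]] := weak_relation_limit model_weak_limits f0 g0 d0 d1.
  exists L, (va ∘ loc e); split.
    apply: (loc_weq_mono ww); rewrite !comp_assoc ef eg -!loc_of_comp -k0 -k1.
    by rewrite !loc_of_comp (loc_path_object PP).
  move=> t c fc; have [c0 ec] := loc_full all_cofibrant fa (loc wa ∘ c).
  have fE (u : @hom Ho a b) : loc wb ∘ u ∘ va ∘ loc c0 ≈ loc wb ∘ (u ∘ c).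
    by rewrite -ec -!comp_assoc (comp_assoc va) va1 comp_idl.
  have fg : homotopic (f0 ∘ c0) (g0 ∘ c0).
    apply: (loc_faithful all_cofibrant fb).
    by rewrite !loc_of_comp -ef -eg !fE fc.
  have [m [m0 m1]] := homotopic_path_object all_cofibrant fg PP.
  have [h [eh _]] := LP _ c0 m m0 m1.
  exists (loc h); split=> //.
  by rewrite -comp_assoc -loc_of_comp eh -ec comp_assoc va1 comp_idl.
Qed.

(** A square commuting in the homotopy category commutes up to homotopy, as [B] is fibrant. Lifting
    that homotopy along [p] makes it commute strictly without changing the class of [a0]. *)
Lemma ho_weak_pullback_fibrant (E B A o : M) (p : hom E B) (h : hom A B)
    (q : hom o E) (r : hom o A) : fib _ _ p -> fibrant B -> fibrant A ->
  is_pullback p h q r -> is_weak_pullback (loc p) (loc h) (loc q) (loc r).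
Proof.
move=> fp fB fA [e pq]; split; first by rewrite -!loc_of_comp e.
move=> t a b eab.
have [a0 ea] := loc_full all_cofibrant (fibrant_fib fp fB) a.
have [b0 eb] := loc_full all_cofibrant fA b.
have hab : homotopic (p ∘ a0) (h ∘ b0).
  by apply: (loc_faithful all_cofibrant fB); rewrite !loc_of_comp -ea -eb.
have [Z [i0 [i1 [s [H [ZP H0 H1]]]]]] := homotopy_lifting all_cofibrant fp hab.
have [k [[k1 k2] _]] := pq _ _ _ H1.
exists (loc k); rewrite -!loc_of_comp k1 k2 eb; split=> //.
by rewrite ea -H0 !loc_of_comp (loc_cylinder ZP).
Qed.

Hypothesis proper : right_proper M.

(* [V -> U] is the pullback of the fibration [x] with fibrant base [J], which
   makes the pullback [W] of [V -> U] along [h] a homotopy pullback although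
   [U] and [U'] need not be fibrant: by right properness [h] can be replaced
   with a fibration between objects fibrant over [J]. *)
Lemma ho_weak_pullback (J X U U' V W : M) (x : hom X J) (u : hom U J)
    (u' : hom U' J) (h : hom U' U) (p1 : hom V U) (p2 : hom V X)
    (r1 : hom W U') (r2 : hom W X) (l : hom W V) :
  fib _ _ x -> fibrant J -> is_pullback u x p1 p2 -> is_pullback u' x r1 r2 ->
  u ∘ h ≈ u' -> p1 ∘ l ≈ h ∘ r1 -> p2 ∘ l ≈ r2 ->
  is_weak_pullback (loc p1) (loc h) (loc l) (loc r1).
Proof.
move=> fx fJ pV pW uh l1 l2.
have [U1 [a [u1 [[wa _] fu1 eu]]]] := factor_tcof_fib u.
have [V1 [P1 [P2 pV1]]] := pullbacks_exist (@model_limits M) u1 x.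
have [|c [[c1 c2] _]] := pV1.2 V (a ∘ p1) p2.
  by rewrite comp_assoc eu; exact: pV.1.
have fP1 : fib _ _ P1 := fib_pullback (pullback_sym pV1) fx.
(* By pasting, [c] is the pullback of the weak equivalence [a] along the fibration [P1]; [c'] is
   treated likewise. *)
have wc : weq _ _ c := proper (pullback_pasting pV1 pV eu c1 c2) wa fP1.
have [U1' [a' [h1 [[wa' _] fh1 eh]]]] := factor_tcof_fib (a ∘ h).
have eu' : u1 ∘ h1 ∘ a' ≈ u' by rewrite -comp_assoc eh comp_assoc eu.
have [W1 [R1 [R2 pW1]]] := pullbacks_exist (@model_limits M) (u1 ∘ h1) x.
have [|c' [[c1' c2'] _]] := pW1.2 W (a' ∘ r1) r2.
  by rewrite comp_assoc eu'; exact: pW.1.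
have fR1 : fib _ _ R1 := fib_pullback (pullback_sym pW1) fx.
have wc' : weq _ _ c' := proper (pullback_pasting pW1 pW eu' c1' c2') wa' fR1.
have [|m [[m1 m2] _]] := pV1.2 W1 (h1 ∘ R1) R2.
  by rewrite comp_assoc; exact: pW1.1.
have fU1 : fibrant U1 := fibrant_fib fu1 fJ.
have [_ wp] := ho_weak_pullback_fibrant fP1 fU1 (fibrant_fib fh1 fU1)
  (pullback_sym (pullback_pasting pV1 pW1 (heq_refl _) m1 m2)).
have mc : m ∘ c' ≈ c ∘ l.
  apply: (pullback_ext pV1).
    by rewrite !comp_assoc m1 c1 -!comp_assoc c1' l1 !comp_assoc eh.
  by rewrite !comp_assoc m2 c2 c2' l2.
split; first by rewrite -!loc_of_comp l1.
move=> t al be eab.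
have [|th1 [t1 t2]] := wp t (loc c ∘ al) (loc a' ∘ be).
  rewrite !comp_assoc -!loc_of_comp c1 eh !loc_of_comp -!comp_assoc.
  by rewrite eab.
have [v [_ v2]] := loc_weq_inverse wc'.
(* The comparisons [a'], [c] and [c'] are invertible in the homotopy category, which carries the
   weak pullback [W1] back to [W]. *)
exists (v ∘ th1); split.
  apply: (loc_weq_mono wc).
  by rewrite !comp_assoc -loc_of_comp -mc loc_of_comp -(comp_assoc _ _ v) v2
    comp_idr t1.
apply: (loc_weq_mono wa').
by rewrite !comp_assoc -loc_of_comp -c1' loc_of_comp -(comp_assoc _ _ v) v2
  comp_idr t2.
Qed.

Hypothesis wdp : has_weak_dependent_products M.

Lemma ho_dependent_full_fibrations (Y X J : M) (y : hom Y X) (x : hom X J) :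
  fib _ _ y -> fib _ _ x -> fibrant J ->
  exists D : @dep_diagram Ho Y X J (loc y) (loc x), is_dependent_full D.
Proof.
move=> fy fx fJ.
have fX : fibrant X := fibrant_fib fx fJ.
have [D [Ddet DP]] := wdp y x.
have [V [q1 [q2 pV]]] := pullbacks_exist (@model_limits M) (du D) x.
have [s [s1 s2]] := (dwpb D).2 V q1 q2 pV.1.
pose F := df D ∘ s.
have yF : y ∘ F ≈ q2 by rewrite comp_assoc df_over s2.
(* This is [ho_weak_pullback] with [J] itself as the first base and [u] as the change of base. *)
have ho_base (U W : M) (u : hom U J) (r1 : hom W U) (r2 : hom W X) :
    is_pullback u x r1 r2 -> is_weak_pullback (loc u) (loc x) (loc r1) (loc r2).
  move=> pW; apply: weak_pullback_sym.
  have pX : is_pullback (idm J) x x (idm X).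
    split=> [|t a b]; first by rewrite comp_idl comp_idr.
    rewrite comp_idl => e; exists b; split; first by rewrite comp_idl e.
    by move=> h' _; rewrite comp_idl.
  by apply: (ho_weak_pullback fx fJ pX pW);
    rewrite ?comp_idl //; symmetry; exact: pW.1.
have hyF : loc y ∘ loc F ≈ loc q2 by rewrite -loc_of_comp yF.
exists (@DepDiagram Ho Y X J (loc y) (loc x) (dU D) V (loc (du D)) (loc q1)
  (loc q2) (loc F) hyF (ho_base _ _ _ _ _ pV)) => D'.
have [u0 eu] := loc_full all_cofibrant fJ (du D').
have [W [r1 [r2 pW]]] := pullbacks_exist (@model_limits M) u0 x.
have [|k [k1 k2]] := (dwpb D').2 W (loc r1) (loc r2).
  by rewrite eu -!loc_of_comp pW.1.
have [g eg] := loc_full all_cofibrant (fibrant_fib fy fX) (df D' ∘ k).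
(* The arrow [g] lies over [r2] only up to homotopy; the covering homotopy [H] replaces it by
   [H ∘ i1], strictly over [r2]. *)
have hg : homotopic (y ∘ g) r2.
  apply: (loc_faithful all_cofibrant fX).
  by rewrite loc_of_comp -eg comp_assoc df_over k2.
have [Z [i0 [i1 [c [H [ZP H0 H1]]]]]] := homotopy_lifting all_cofibrant fy hg.
pose D'' := DepDiagram H1 (pullback_weak pW).
have [|h [l [/= h1 l1 l2 l3]]] := DP D''.
  by move=> t a b /= e1 e2; apply: comp_eql; apply: (pullback_ext pW).
have [|m [[m1 m2] _]] := pV.2 W (h ∘ r1) r2.
  by rewrite comp_assoc h1; exact: pW.1.
(* The arrows [s ∘ m] and [l] have the same projections, so [df D], being determined by projections,
   agrees on them. *)
have Fm : F ∘ m ≈ H ∘ i1.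
  rewrite -l3 /F -comp_assoc; apply: Ddet; rewrite comp_assoc.
    by rewrite s1 m1 l1.
  by rewrite s2 m2 l2.
have e1 : loc (du D) ∘ loc h ≈ du D' by rewrite -loc_of_comp h1 eu.
have e2 : dp2 D' ∘ k ≈ loc q2 ∘ loc m by rewrite -loc_of_comp m2.
have e3 : df D' ∘ k ≈ loc F ∘ loc m.
  by rewrite -loc_of_comp eg Fm -H0 !loc_of_comp (loc_cylinder ZP).
exists (loc h), W, (loc m), (loc r1), k; split; first exact: e1.
split; first exact: (ho_weak_pullback fx fJ pV pW h1 m1 m2).
by split; [exact: k1 | exact: e2 | exact: e3].
Qed.

Lemma ho_fibration_replacement (X0 : M) (X : M) (fX : fibrant X)
    (f : @hom Ho X0 X) : exists (Y : M) (w : hom X0 Y) (p : hom Y X),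
  [/\ weq _ _ w, fib _ _ p & loc p ∘ loc w ≈ f].
Proof.
have [g eg] := loc_full all_cofibrant fX f.
have [Y [w [p [[ww _] fp e]]]] := factor_tcof_fib g.
by exists Y, w, p; split=> //; rewrite eg -loc_of_comp e.
Qed.

Lemma ho_dependent_full_diagrams : has_dependent_full_diagrams Ho.
Proof.
move=> Y0 X0 J0 y0 x0.
(* Replacement proceeds from the base upwards, so that each new fibration has a fibrant codomain. *)
have [J [iJ [fJ [wJ _]]]] := fibrant_replacement (J0 : M).
have [X [iX [x [wX fx ex]]]] := ho_fibration_replacement fJ (loc iJ ∘ x0).
have fX : fibrant X := fibrant_fib fx fJ.
have [Y [iY [y [wY fy ey]]]] := ho_fibration_replacement fX (loc iX ∘ y0).
have [vJ [vJ1 vJ2]] := loc_weq_inverse wJ.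
have [vX [vX1 vX2]] := loc_weq_inverse wX.
have [vY [vY1 vY2]] := loc_weq_inverse wY.
apply: dependent_full_iso vY1 vY2 vX1 vX2 vJ1 vJ2 ey ex _.
exact: ho_dependent_full_fibrations.
Qed.

End HomotopyCategoryLimits.

Theorem theorem4p10 (M : model_category)
    (M_right_proper : right_proper M)
    (M_cofibrant : forall x : M, cofibrant x)
    (M_weak_dependent_products : has_weak_dependent_products M) :
  has_weak_finite_limits (homotopy_category M) /\
  has_dependent_full_diagrams (homotopy_category M) /\
  locally_cartesian_closed (exact_completion (homotopy_category M)).
Proof.
have wlim := ho_weak_finite_limits M_cofibrant.
have full := ho_dependent_full_diagrams M_cofibrant M_right_proper
  M_weak_dependent_products.
by split=> //; split=> //; apply: ex_locally_cartesian_closed.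
Qed.
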